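(* Let $1<p\le q<\infty$, $\alpha>-1$ and $0\le\gamma<2+\alpha$. Let $\mu$ be a positive measure and $\sigma$ a weight on $\mathcal H$. The following are equivalent: (a) there is $C_1>0$ such that for every $f$, $$\left(\int_{\mathcal H}\big(\mathcal M_{\alpha,\gamma}(\sigma f)\big)^q d\mu\right)^{1/q}\le C_1\left(\int_{\mathcal H}|f|^p\sigma\,dV_\alpha\right)^{1/p};$$ (b) there is $C_2>0$ such that for every interval $I\subset\mathbb R$, $$\left(\int_{\mathcal H}\big(\mathcal M_{\alpha,\gamma}(\chi_{Q_I}\sigma)\big)^q d\mu\right)^{1/q}\le C_2|Q_I|_{\sigma,\alpha}^{1/p}.$$ Moreover, the smallest constant $C_1$ in (a) is comparable (with constants depending only on $p,q,\alpha,\gamma$) to $$\sup_{I\subset\mathbb R}\frac{\left(\int_{\mathcal H}\big(\mathcal M_{\alpha,\gamma}(\chi_{Q_I}\sigma)\big)^q d\mu\right)^{1/q}}{|Q_I|_{\sigma,\alpha}^{1/p}}.$$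
   Context: $\mathcal H=\{x+iy:x\in\mathbb R,\ y>0\}$; for $\alpha>-1$, $dV_\alpha(x+iy)=y^\alpha dx\,dy$. A weight is a nonnegative locally integrable function on $\mathcal H$. For a weight $\sigma$ and $E\subset\mathcal H$, $|E|_{\sigma,\alpha}=\int_E\sigma\,dV_\alpha$. For an interval $I\subset\mathbb R$, $Q_I=\{x+iy:x\in I,\ 0<y<|I|\}$ and $\chi_{Q_I}$ its indicator. For $0\le\gamma<2+\alpha$ and locally integrable $f$, $\mathcal M_{\alpha,\gamma}f(z)=\sup\{|I|^{-(2+\alpha-\gamma)}\int_{Q_I}|f|\,dV_\alpha:\ I\subset\mathbb R\text{ an interval with } z\in Q_I\}$.
   Formalization: The weight σ is assumed to have |Q_I|_{σ,α} finite for every bounded interval I, not merely to be locally integrable on H; otherwise the equivalence fails, e.g. for σ = y^{-1-α} and any nonzero μ, where (b) is trivial and (a) is false. *)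

(* Defs.v *)
From HB Require Import structures.
From mathcomp Require Import all_boot all_order all_algebra.
From mathcomp Require Import all_classical all_reals all_analysis.
Set Implicit Arguments. Unset Strict Implicit. Unset Printing Implicit Defensive.
Import Order.TTheory GRing.Theory Num.Theory.
Local Open Scope classical_set_scope.
Local Open Scope ring_scope.

Definition UHP {R : realType} : set (R * R) := [set z | 0 < z.2].

Definition leb2 {R : realType} := ((@lebesgue_measure R) \x (@lebesgue_measure R))%E.

Definition Vint {R : realType} (alpha : R) (D : set (R * R)) (g : R * R -> \bar R)
  : \bar R :=
  (\int[leb2]_(w in D) (g w * (w.2 `^ alpha)%:E))%E.

Definition Qbox {R : realType} (a b : R) : set (R * R) :=
  [set z | a < z.1 < b /\ 0 < z.2 < b - a].

Definition wmeas {R : realType} (sigma : R * R -> R) (alpha : R) (E : set (R * R))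
  : \bar R := Vint alpha E (fun w => (sigma w)%:E).

Definition Mfrac {R : realType} (alpha gamma : R) (f : R * R -> R) (z : R * R)
  : \bar R :=
  ereal_sup [set (((ab.2 - ab.1) `^ (- (2 + alpha - gamma)))%:E
                 * Vint alpha (Qbox ab.1 ab.2) (fun w => (`|f w|)%:E))%E
            | ab in [set ab : R * R | ab.1 < ab.2 /\ Qbox ab.1 ab.2 z]].

Local Open Scope ereal_scope.

Definition is_weight {R : realType} (alpha : R) (sigma : R * R -> R) : Prop :=
  (forall z, (0 <= sigma z)%R) /\ measurable_fun UHP sigma /\
  (forall a b : R, (a < b)%R -> wmeas sigma alpha (Qbox a b) < +oo).

Definition LqM {R : realType} (mu : {measure set (R * R) -> \bar R})
  (q alpha gamma : R) (g : R * R -> R) : \bar R :=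
  (\int[mu]_(z in UHP) (Mfrac alpha gamma g z `^ q)) `^ (q^-1)%R.

Definition condA {R : realType} (mu : {measure set (R * R) -> \bar R})
  (sigma : R * R -> R) (p q alpha gamma C : R) : Prop :=
  forall f : R * R -> R, measurable_fun UHP f ->
    LqM mu q alpha gamma (fun w => (sigma w * f w)%R)
    <= C%:E * (Vint alpha UHP (fun w => ((`|f w| `^ p) * sigma w)%:E)) `^ (p^-1)%R.

Definition condB {R : realType} (mu : {measure set (R * R) -> \bar R})
  (sigma : R * R -> R) (p q alpha gamma C : R) : Prop :=
  forall a b : R, (a < b)%R ->
    LqM mu q alpha gamma (fun w => (\1_(Qbox a b) w * sigma w)%R)
    <= C%:E * (wmeas sigma alpha (Qbox a b)) `^ (p^-1)%R.

(* The smallest constant in (a) (infimum; +oo if (a) holds for no C > 0) *)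
Definition bestA {R : realType} (mu : {measure set (R * R) -> \bar R})
  (sigma : R * R -> R) (p q alpha gamma : R) : \bar R :=
  ereal_inf [set C%:E | C in [set C : R | (0 < C)%R /\ condA mu sigma p q alpha gamma C]].

(* sup over intervals I of (int (M(chi_{Q_I} sigma))^q dmu)^{1/q} / |Q_I|_{sigma,alpha}^{1/p};
   intervals with |Q_I|_{sigma,alpha} = 0 (for which the numerator is 0 too) are
   given the value 0. *)
Definition testSup {R : realType} (mu : {measure set (R * R) -> \bar R})
  (sigma : R * R -> R) (p q alpha gamma : R) : \bar R :=
  ereal_sup ([set 0] `|`
    [set LqM mu q alpha gamma (fun w => (\1_(Qbox ab.1 ab.2) w * sigma w)%R)
         * ((fine (wmeas sigma alpha (Qbox ab.1 ab.2)) `^ (p^-1)) ^-1)%R%:E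
    | ab in [set ab : R * R | (ab.1 < ab.2)%R /\ 0 < wmeas sigma alpha (Qbox ab.1 ab.2)]]).

(* Main.v *)
(** For an interval family that is laminar (any two boxes [Q_I] nested or
    disjoint), assign to each point the interval whose average of [sigma f] is
    the largest. With [E_I] the set of points assigned to [I],
    [w_I = mu(E_I) (|I|^-s |Q_I|_sigma)^q] and [A_I] the [sigma]-average of
    [|f|] over [Q_I], the [q]-th power of the maximal function integrates to
    [sum_I w_I A_I^q]. Condition (b) for [Q_J] bounds the sum of the [w_I] with
    [Q_I] inside [Q_J] by a multiple of [|Q_J|_sigma^(q/p)], and the Carleson
    embedding theorem concludes. The latter is proved by cutting the averages at
    the levels [e 2^k] and summing a geometric series, which converges because
    [p > 1].

    General intervals reduce to two laminar families: an interval of length [d]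
    is contained in a cell of comparable length of one of two dyadic grids, the
    second one being shifted by a third. Every interval is also contained in one
    of at most twice its length from a countable family, so that monotone
    convergence reduces the problem to finitely many intervals. *)
Require Import Defs.
From HB Require Import structures.
From mathcomp Require Import all_boot all_order all_algebra.
From mathcomp Require Import all_classical all_reals all_analysis.
From mathcomp Require Import measurable_realfun zify ring lra.
Import Order.TTheory GRing.Theory Num.Theory.
Local Open Scope classical_set_scope.
Local Open Scope ring_scope.

(** * Power sums over dyadic levels *)

(** Each power is split as [x * x^(r - 1)]; since [r - 1 >= 0], both [a^(r - 1)] and [b^(r - 1)] are
    at most [(a + b)^(r - 1)]. *)
Lemma powR_superadd (R : realType) (r a b : R) : 1 <= r -> 0 <= a -> 0 <= b ->
  a `^ r + b `^ r <= (a + b) `^ r.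
Proof.
move=> r1 a0 b0; have r0 : 0 < r by lra.
have r10 : 0 <= r - 1 by lra.
rewrite -(mulr_powRB1 _ r0)// -(mulr_powRB1 b0 r0)// -(mulr_powRB1 (addr_ge0 a0 b0) r0).
rewrite mulrDl lerD// ler_wpM2l// ge0_ler_powR// ?nnegrE ?addr_ge0//; lra.
Qed.

Lemma sum_powR_superadd (R : realType) (I : Type) (s : seq I) (P : pred I) (r : R)
    (a : I -> R) : 1 <= r -> (forall i, 0 <= a i) ->
  \sum_(i <- s | P i) a i `^ r <= (\sum_(i <- s | P i) a i) `^ r.
Proof.
move=> r1 a0.
suff: 0 <= \sum_(i <- s | P i) a i /\
  \sum_(i <- s | P i) a i `^ r <= (\sum_(i <- s | P i) a i) `^ r by case.
elim/big_rec2 : _ => [|i x y Pi [y0 xy]]; first by rewrite powR_ge0.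
split; first by rewrite addr_ge0.
by rewrite (le_trans _ (powR_superadd _ _ _ _ _ _ _))// lerD2l.
Qed.

Lemma powR_gt1 (R : realType) (a r : R) : 1 < a -> 0 < r -> 1 < a `^ r.
Proof.
move=> a1 r0; have -> : 1 = (1 : R) `^ r by rewrite powR1.
by apply: gt0_ltr_powR; rewrite ?nnegrE//; lra.
Qed.

(** The terms form a geometric progression of ratio [l = 2^(p - 1) > 1], so the sum is at most
    [l / (l - 1)] times its last nonzero term, whose level lies below [t]. *)
Lemma geometric_level_sum (R : realType) (p e t : R) (n : nat) :
  1 < p -> 0 < e -> 0 <= t ->
  \sum_(k < n) (if e * 2 ^+ k < t then (e * 2 ^+ k) `^ (p - 1) else 0) <=
    2 `^ (p - 1) / (2 `^ (p - 1) - 1) * t `^ (p - 1).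
Proof.
move=> p1 e0 t0; set l : R := 2 `^ (p - 1).
have l1 : 1 < l by apply: powR_gt1; lra.
have C0 : 0 <= l / (l - 1) by rewrite divr_ge0; lra.
pose b k := (e * 2 ^+ k) `^ (p - 1).
have bS k : b k.+1 = l * b k.
  have be0 : 0 <= e * 2 ^+ k by rewrite mulr_ge0 ?exprn_ge0// ltW.
  by rewrite /b /l -powRM// exprS mulrCA.
have tot m : \sum_(k < m.+1) b k <= l / (l - 1) * b m.
  elim: m => [|m ih].
    rewrite big_ord1 ler_peMl ?powR_ge0// ler_pdivlMr; lra.
  rewrite big_ord_recr/= bS (le_trans (lerD ih (lexx _)))//.
  rewrite -subr_ge0 (_ : _ - _ = 0)//; field; lra.
elim: n => [|n ih]; first by rewrite big_ord0 mulr_ge0// powR_ge0.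
case: (ltP (e * 2 ^+ n) t) => h; last first.
  by rewrite big_ord_recr/= ltNge h/= addr0.
apply: (@le_trans _ _ (\sum_(k < n.+1) b k)).
  by apply: ler_sum => k _; case: ifP => // _; exact: powR_ge0.
rewrite (le_trans (tot n))// ler_wpM2l// ge0_ler_powR ?nnegrE//; last exact: ltW.
  lra.
by rewrite mulr_ge0// ?exprn_ge0// ltW.
Qed.

(** One term is enough: the highest level below [a] is at least [a / 2]. Such a level exists for
    [a > 0] because [e < a]. *)
Lemma powR_le_level_sum (R : realType) (q e a : R) (n : nat) : 0 < q -> 0 < e ->
  0 <= a -> (0 < a -> e < a) -> a <= e * 2 ^+ n ->
  a `^ q <= \sum_(k < n) (if e * 2 ^+ k < a then (2 * (e * 2 ^+ k)) `^ q else 0).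
Proof.
move=> q0 e0 a0 ea; elim: n => [|n ih] an.
  rewrite big_ord0; have /eqP-> : a == 0.
    rewrite eq_le a0 andbT leNgt; apply/negP => /ea; rewrite ltNge; move: an.
    by rewrite expr0 mulr1 => ->.
  by rewrite powR0// gt_eqF.
rewrite big_ord_recr/=; case: ltP => h; last by rewrite addr0 ih.
rewrite -[leLHS]add0r lerD//.
  by apply: sumr_ge0 => k _; case: ifP => // _; exact: powR_ge0.
rewrite ge0_ler_powR ?nnegrE//; [exact: ltW| |by rewrite mulrCA -exprS].
by rewrite mulr_ge0// mulr_ge0 ?exprn_ge0// ltW.
Qed.

(** Finitely many averages need only finitely many levels: [e] lies below all the positive ones and
    [e 2^n] dominates them all. *)
Lemma finite_level_range (R : realType) (s : seq R) :
  exists (e : R) (n : nat), 0 < e /\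
    forall a, a \in s -> (0 < a -> e < a) /\ a <= e * 2 ^+ n.
Proof.
have [e e0 es] : exists2 e : R, 0 < e & forall a, a \in s -> 0 < a -> e < a.
  elim: s => [|x s [e e0 es]]; first by exists 1.
  have [x0|x0] := ltP 0 x; last first.
    by exists e => // a; rewrite inE => /orP[/eqP->|/es//]; rewrite ltNge x0.
  exists (Num.min e (x / 2)); first by rewrite lt_min e0/=; lra.
  move=> a; rewrite inE gt_min => /orP[/eqP-> _|/es h /h ->//].
  by apply/orP; right; lra.
have [n sn] : exists n, forall a, a \in s -> a <= e * 2 ^+ n; last first.
  by exists e, n; split=> // a sa; split; [exact: es|exact: sn].
elim: s {es} => [|x s [n sn]]; first by exists 0%N.
exists (maxn n (Num.truncn (x / e)).+1) => a; rewrite inE => /orP[/eqP->|sa].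
  rewrite mulrC -ler_pdivrMr//.
  have := truncnS_gt (x / e) => /ltW/le_trans; apply.
  rewrite -natrX ler_nat (leq_trans (ltnW (ltn_expl _ (ltnSn 1))))//.
  by rewrite leq_exp2l// leq_maxr.
rewrite (le_trans (sn _ sa))// ler_pM2l// ler_weXn2l ?leq_maxl//; lra.
Qed.

(** * Laminar families *)

(** Selects maximal sets by induction. A new set already inside a selected one is dropped; otherwise
    it replaces the selected sets it contains, and laminarity makes it disjoint from the others. *)
Lemma laminar_cover (T : Type) (I : eqType) (Q : I -> set T) (s : seq I) :
  (forall i j, Q i `<=` Q j \/ Q j `<=` Q i \/ Q i `&` Q j = set0) -> uniq s ->
  exists s' : seq I, [/\ uniq s', {subset s' <= s}, trivIset [set` s'] Q &
    forall i, i \in s -> exists2 j, j \in s' & Q i `<=` Q j].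
Proof.
move=> lamQ; elim: s => [|i s ih] /=; first by exists [::]; split.
move=> /andP[si /ih [s' [us' s's tQ cov]]].
have [[j js' Qij]|nQ] := pselect (exists2 j, j \in s' & Q i `<=` Q j).
  exists s'; split => // k; first by move/s's; rewrite inE orbC => ->.
  by rewrite inE => /orP[/eqP->|/cov//]; exists j.
pose far j := ~~ `[< Q j `<=` Q i >].
exists (i :: [seq j <- s' | far j]); split => /=.
- rewrite filter_uniq// andbT mem_filter; apply/negP => /andP[_ /s's].
  by rewrite (negbTE si).
- by move=> k; rewrite !inE mem_filter => /orP[->//|/andP[_ /s's->]]; rewrite orbT.
- have disj k : k \in s' -> far k -> Q i `&` Q k = set0.
    move=> ks' /asboolPn fark; case: (lamQ i k) => [ik|[//|//]].
    by exfalso; apply: nQ; exists k.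
  apply/trivIsetP => j k /=; rewrite !inE !mem_filter.
  move=> /orP[/eqP->|/andP[fj js']] /orP[/eqP->|/andP[fk ks']].
  + by rewrite eqxx.
  + by move=> _; exact: disj.
  + by move=> _; rewrite setIC; exact: disj.
  + by move/trivIsetP : tQ; exact.
- move=> k; rewrite inE => /orP[/eqP->|/cov[j js' Qkj]].
    by exists i => //; rewrite inE eqxx.
  have [/asboolP fj|fj] := boolP (`[< Q j `<=` Q i >]).
    by exists i; [rewrite inE eqxx|exact: subset_trans fj].
  by exists j => //; rewrite inE mem_filter js' andbT /far fj orbT.
Qed.

(** Each index of [P] is charged to a maximal set containing it. The Carleson condition bounds the
    charge of each maximal set, and superadditivity of the power [r >= 1] adds up these bounds. *)
Lemma carleson_sum_cover (R : realType) (T : Type) (I : finType) (Q : I -> set T)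
    (w nu : I -> R) (B r : R) (P : pred I) :
  (forall i j, Q i `<=` Q j \/ Q j `<=` Q i \/ Q i `&` Q j = set0) ->
  (forall i, 0 <= w i) -> (forall i, 0 <= nu i) -> 0 <= B -> 1 <= r ->
  (forall j, \sum_(i | `[< Q i `<=` Q j >]) w i <= B * nu j `^ r) ->
  exists s : seq I, [/\ uniq s, {subset s <= P}, trivIset [set` s] Q &
    \sum_(i | P i) w i <= B * (\sum_(j <- s) nu j) `^ r].
Proof.
move=> lamQ w0 nu0 B0 r1 carl.
have [s [us sP tQ cov]] := @laminar_cover T I Q (enum P) lamQ (enum_uniq P).
exists s; split => //; first by move=> i /sP; rewrite mem_enum.
apply: (@le_trans _ _ (\sum_(i | P i) \sum_(j <- s | `[< Q i `<=` Q j >]) w i)).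
  apply: ler_sum => i Pi; have [|j js Qij] := cov i; first by rewrite mem_enum.
  rewrite (big_rem j)//= asboolT// lerDl.
  by apply: sumr_ge0.
rewrite (exchange_big_dep predT)//=.
apply: (@le_trans _ _ (\sum_(j <- s) B * nu j `^ r)).
  apply: ler_sum => j _; rewrite (le_trans _ (carl j))//.
  rewrite big_mkcond [leRHS]big_mkcond/=; apply: ler_sum => i _.
  by case: (P i); case: asboolP.
by rewrite -mulr_sumr ler_wpM2l// sum_powR_superadd.
Qed.

(** * The Carleson embedding *)

(** The integral of a nonnegative function is a supremum over simple functions below it, hence
    monotone without measurability. This matters because the maximal function is not shown to be
    measurable. *)
Lemma ge0_le_integral_nomeas d (T : measurableType d) (R : realType)
    (mu : {measure set T -> \bar R}) (D : set T) (f g : T -> \bar R) :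
  (forall x, D x -> 0 <= f x)%E -> (forall x, D x -> f x <= g x)%E ->
  (\int[mu]_(x in D) f x <= \int[mu]_(x in D) g x)%E.
Proof.
move=> f0 fg.
have g0 x : D x -> (0 <= g x)%E by move=> Dx; exact: le_trans (f0 _ Dx) (fg _ Dx).
rewrite !ge0_integralE//; apply: ereal_sup_le => _ [k kf <-]; exists k => // x.
by apply: (le_trans (kf x)); rewrite !patchE; case: ifPn => // /set_mem/fg.
Qed.

Lemma sum_integral_trivIset_le d (T : measurableType d) (R : realType)
    (mu : {measure set T -> \bar R}) (D : set T) (g : T -> \bar R) (I : eqType)
    (Q : I -> set T) (s : seq I) :
  measurable D -> measurable_fun D g -> (forall x, D x -> 0 <= g x)%E ->
  (forall i, measurable (Q i)) -> (forall i, Q i `<=` D) -> uniq s ->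
  trivIset [set` s] Q ->
  (\sum_(j <- s) \int[mu]_(x in Q j) g x <= \int[mu]_(x in D) g x)%E.
Proof.
move=> mD mg g0 mQ QD us tQ.
have UD : \big[setU/set0]_(i <- s) Q i `<=` D.
  by elim/big_ind : _ => // A B AD BD; rewrite subUset.
rewrite -ge0_integral_bigsetU//; last 2 first.
- exact: measurable_funS mg.
- by move=> x /UD; exact: g0.
by apply: ge0_subset_integral => //; exact: bigsetU_measurable.
Qed.

Lemma integral_sum_cst_indic d (T : measurableType d) (R : realType)
    (mu : {measure set T -> \bar R}) (D : set T) (I : Type) (s : seq I)
    (E : I -> set T) (a : I -> R) :
  measurable D -> (forall i, measurable (E i)) -> (forall i, E i `<=` D) ->
  (forall i, 0 <= a i) ->
  (\int[mu]_(x in D) (\sum_(i <- s) a i * \1_(E i) x)%:E =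
   \sum_(i <- s) (a i)%:E * mu (E i))%E.
Proof.
move=> mD mE ED a0.
under eq_integral do rewrite -sumEFin.
rewrite ge0_integral_sum//.
- apply: eq_bigr => i _; under eq_integral do rewrite EFinM.
  rewrite ge0_integralZl_EFin ?integral_indic//; last first.
    by apply/measurable_EFinP; exact: measurable_indic.
  by rewrite setIidl.
- by move=> i; apply/measurable_EFinP; apply: measurable_funM => //; exact: measurable_indic.
by move=> i x _; rewrite lee_fin mulr_ge0.
Qed.

Lemma measurable_level d (T : measurableType d) (R : realType) (D : set T)
    (h u : T -> R) (t : R) :
  measurable D -> measurable_fun D h -> measurable_fun D u ->
  measurable_fun D (fun x => (if t < 2 * u x then u x * h x else 0)%:E).
Proof.
move=> mD mh mu; apply/measurable_EFinP; apply: measurable_fun_if => //.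
- by apply: measurable_fun_ltr => //; exact: measurable_funM.
- apply: (@measurable_funS _ _ _ _ D) => //; exact: measurable_funM.
Qed.

(* On a set of average [F / nu] above [t], the part of [u] below [t / 2] carries
   at most half of the integral of [u h]. *)
Lemma high_average_mass d (T : measurableType d) (R : realType)
    (m : {measure set T -> \bar R}) (A : set T) (h u : T -> R) (t nu F : R) :
  measurable A -> measurable_fun A h -> measurable_fun A u ->
  (forall x, A x -> 0 <= h x) -> (forall x, A x -> 0 <= u x) -> 0 < t ->
  (\int[m]_(x in A) (h x)%:E = nu%:E)%E ->
  (\int[m]_(x in A) (u x * h x)%:E = F%:E)%E ->
  t * nu <= F ->
  ((t / 2 * nu)%:E <=
    \int[m]_(x in A) (if t < 2 * u x then u x * h x else 0)%:E)%E.
Proof.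
move=> mA mh mu h0 u0 t0 hnu hF tF.
have F_le : (F%:E <= \int[m]_(x in A) (if t < 2 * u x then u x * h x else 0)%:E
    + (t / 2 * nu)%:E)%E.
  rewrite -hF EFinM -hnu -ge0_integralZl_EFin//; last 2 first.
  - exact/measurable_EFinP.
  - lra.
  rewrite -ge0_integralD//; last 4 first.
  - by move=> x Ax; rewrite lee_fin; case: ifP => // _; rewrite mulr_ge0 ?u0 ?h0.
  - exact: measurable_level.
  - by move=> x Ax; rewrite -EFinM lee_fin mulr_ge0 ?h0//; lra.
  - by apply/measurable_EFinP; apply: measurable_funM.
  apply: ge0_le_integral_nomeas => x Ax; first by rewrite lee_fin mulr_ge0 ?u0 ?h0.
  rewrite -EFinM -EFinD lee_fin; have := h0 _ Ax; case: ltP => ? ?; nra.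
have : (F%:E - (t / 2 * nu)%:E <=
    \int[m]_(x in A) (if t < 2 * u x then u x * h x else 0)%:E)%E.
  by rewrite leeBlDr.
apply: le_trans; rewrite -EFinB lee_fin; lra.
Qed.

(** Sum and integral are exchanged. At a point [x], the geometric sum up to [2 u x] contributes
    [(2 u x)^(p - 1)], and the remaining factor [u x * h x] completes it to [u^p h]. *)
Lemma sum_level_integral_le d (T : measurableType d) (R : realType)
    (m : {measure set T -> \bar R}) (D : set T) (h u : T -> R) (p e : R) (n : nat) :
  measurable D -> measurable_fun D h -> measurable_fun D u ->
  (forall x, D x -> 0 <= h x) -> (forall x, D x -> 0 <= u x) ->
  1 < p -> 0 < e ->
  (\sum_(k < n) ((e * 2 ^+ k) `^ (p - 1))%:E *
      \int[m]_(x in D) (if e * 2 ^+ k < 2 * u x then u x * h x else 0)%:E <=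
    (2 `^ (p - 1) / (2 `^ (p - 1) - 1) * 2 `^ (p - 1))%:E *
      \int[m]_(x in D) (u x `^ p * h x)%:E)%E.
Proof.
move=> mD mh mu h0 u0 p1 e0.
have C0 : 0 <= 2 `^ (p - 1) / (2 `^ (p - 1) - 1) :> R.
  have := @geometric_level_sum R p 1 1 0 p1 ltr01 ler01.
  by rewrite big_ord0 powR1 mulr1.
have g0 k x : D x -> (0 <= (if e * 2 ^+ k < 2 * u x then u x * h x else 0)%:E)%E.
  by move=> Dx; rewrite lee_fin; case: ifP => // _; rewrite mulr_ge0 ?u0 ?h0.
rewrite -ge0_integralZl_EFin//; last 3 first.
- by move=> x Dx; rewrite lee_fin mulr_ge0 ?powR_ge0 ?h0.
- apply/measurable_EFinP; apply: measurable_funM => //.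
  exact: measurableT_comp (measurable_powR _) mu.
- by rewrite mulr_ge0// powR_ge0.
under eq_bigr => k _.
  rewrite -ge0_integralZl_EFin//; [over|exact: g0|exact: measurable_level|exact: powR_ge0].
rewrite -ge0_integral_sum//; last 2 first.
- by move=> k; apply: measurable_funeM; exact: measurable_level.
- by move=> k x Dx; rewrite mule_ge0 ?g0// lee_fin powR_ge0.
apply: ge0_le_integral_nomeas => x Dx.
  by apply: sume_ge0 => k _; rewrite mule_ge0 ?g0// lee_fin powR_ge0.
under eq_bigr do rewrite -EFinM.
rewrite sumEFin -EFinM lee_fin.
rewrite (eq_bigr (fun k : 'I_n => u x * h x *
    (if e * 2 ^+ k < 2 * u x then (e * 2 ^+ k) `^ (p - 1) else 0))); last first.
  by move=> k _; case: ifP => _; rewrite ?mulr0// mulrC.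
rewrite -mulr_sumr.
have p0 : 0 < p by lra.
have uh0 : 0 <= u x * h x by rewrite mulr_ge0 ?u0 ?h0.
apply: (le_trans (ler_wpM2l uh0 (@geometric_level_sum _ p _ _ _ p1 e0 _))).
  by rewrite mulr_ge0 ?u0.
rewrite powRM ?u0// -(mulr_powRB1 (u0 _ Dx) p0).
by rewrite le_eqVlt; apply/orP; left; apply/eqP; ring.
Qed.

(** The sum of the [w i] over the averages above a level [t] is controlled by the mass of the
    maximal sets. By [high_average_mass], this mass is at most [2 / t] times the integral of the
    part of [u h] where [u > t / 2]. Summing over the levels then gives the [p]-th power of [u]. *)
Lemma carleson_embedding d (T : measurableType d) (R : realType)
    (m : {measure set T -> \bar R}) (D : set T) (h u : T -> R) (I : finType)
    (Q : I -> set T) (w nu F : I -> R) (B p r X : R) :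
  measurable D -> measurable_fun D h -> measurable_fun D u ->
  (forall x, D x -> 0 <= h x) -> (forall x, D x -> 0 <= u x) ->
  (forall i, measurable (Q i)) -> (forall i, Q i `<=` D) ->
  (forall i j, Q i `<=` Q j \/ Q j `<=` Q i \/ Q i `&` Q j = set0) ->
  (forall i, 0 <= w i) -> 0 <= B -> 1 < p -> 1 <= r ->
  (forall i, \int[m]_(x in Q i) (h x)%:E = (nu i)%:E)%E ->
  (forall i, \int[m]_(x in Q i) (u x * h x)%:E = (F i)%:E)%E ->
  (\int[m]_(x in D) (u x `^ p * h x)%:E = X%:E)%E ->
  (forall j, \sum_(i | `[< Q i `<=` Q j >]) w i <= B * nu j `^ r) ->
  \sum_i w i * (F i / nu i) `^ (p * r) <=
    (4 `^ p * (2 `^ (p - 1) / (2 `^ (p - 1) - 1))) `^ r * B * X `^ r.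
Proof.
move=> mD mh mu h0 u0 mQ QD lamQ w0 B0 p1 r1 hnu hF hX carl.
have nu0 i : 0 <= nu i.
  by rewrite -lee_fin -hnu; apply: integral_ge0 => x /QD Dx; rewrite lee_fin h0.
have F0 i : 0 <= F i.
  rewrite -lee_fin -hF; apply: integral_ge0 => x /QD Dx.
  by rewrite lee_fin mulr_ge0 ?u0 ?h0.
have X0 : 0 <= X.
  rewrite -lee_fin -hX; apply: integral_ge0 => x Dx.
  by rewrite lee_fin mulr_ge0 ?powR_ge0 ?h0.
have p0 : 0 < p by lra.
have r0 : 0 < r by lra.
pose A i := F i / nu i.
have A0 i : 0 <= A i by rewrite divr_ge0.
have [e [n [e0 en]]] := finite_level_range R [seq A i | i <- enum I].
have Ae i : 0 < A i -> e < A i by have [] := en (A i) (map_f _ (mem_enum _ i)).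
have An i : A i <= e * 2 ^+ n by have [] := en (A i) (map_f _ (mem_enum _ i)).
pose t k := e * 2 ^+ k : R.
have t0 k : 0 < t k by rewrite mulr_gt0// exprn_gt0.
pose G k := (\int[m]_(x in D) (if t k < 2 * u x then u x * h x else 0)%:E)%E.
have G0 k : (0 <= G k)%E.
  apply: integral_ge0 => x Dx; rewrite lee_fin.
  by case: ifP => // _; rewrite mulr_ge0 ?u0 ?h0.
set c := 2 `^ (p - 1) / (2 `^ (p - 1) - 1) in |- *.
have Gsum : (\sum_(k < n) (t k `^ (p - 1))%:E * G k <= (c * 2 `^ (p - 1) * X)%:E)%E.
  by rewrite EFinM -hX; exact: sum_level_integral_le.
(* All weights in [Gsum] are positive, so a single infinite [G k] would make that sum infinite. *)
have Gfin (k : 'I_n) : G k \is a fin_num.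
  rewrite ge0_fin_numE// ltNge leye_eq; apply/negP => /eqP Gk.
  move: Gsum; rewrite (bigD1 k)//= Gk gt0_muley ?lte_fin ?powR_gt0//.
  rewrite addye ?leye_eq// gt_eqF// (lt_le_trans ltNy0)//.
  by apply: sume_ge0 => j _; rewrite mule_ge0 ?lee_fin ?powR_ge0.
pose Y (k : 'I_n) := fine (G k).
have Y0 k : 0 <= Y k by rewrite fine_ge0.
have Ysum : \sum_(k < n) t k `^ (p - 1) * Y k <= c * 2 `^ (p - 1) * X.
  rewrite -lee_fin -sumEFin (le_trans _ Gsum)//.
  by apply: lee_sum => k _; rewrite EFinM fineK.
have level (k : 'I_n) : \sum_(i | t k < A i) w i <= B * (2 / t k * Y k) `^ r.
  have [s [us sA tQ ws]] := @carleson_sum_cover R T I Q w nu B r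
    (fun i => t k < A i) lamQ w0 nu0 B0 r1 carl.
  rewrite (le_trans ws)// ler_wpM2l//.
  have s0 : 0 <= \sum_(j <- s) nu j by exact: sumr_ge0.
  rewrite ge0_ler_powR ?nnegrE ?mulr_ge0// ?invr_ge0 ?(ltW r0) ?(ltW (t0 k))//.
  have k0 : 0 <= 2 / t k by rewrite divr_ge0// ltW.
  suff /(ler_wpM2l k0) : t k / 2 * \sum_(j <- s) nu j <= Y k.
    by rewrite mulrA (_ : 2 / t k * (t k / 2) = 1) ?mul1r//; field; rewrite gt_eqF.
  rewrite -lee_fin (fineK (Gfin k)).
  apply: le_trans (@sum_integral_trivIset_le _ _ _ m _ _ _ Q s mD _ _ mQ QD us tQ).
  - rewrite mulr_sumr -sumEFin big_seq [leRHS]big_seq; apply: lee_sum => j js.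
    apply: (high_average_mass _ _ _ _ _ _ _ _ _ (F j)) => //.
    + exact: measurable_funS mh.
    + exact: measurable_funS mu.
    + by move=> x /QD; exact: h0.
    + by move=> x /QD; exact: u0.
    + have := sA _ js; rewrite unfold_in /A => tA.
      (* By the convention on division, a null set has average 0, which is not above the level. *)
      have nuj : 0 < nu j.
        rewrite lt_neqAle nu0 andbT eq_sym; apply/eqP => nuj.
        by move: tA; rewrite nuj invr0 mulr0 ltNge ltW.
      by rewrite -ler_pdivlMr// ltW.
  - exact: measurable_level.
  - move=> x Dx; rewrite lee_fin.
    by case: ifP => // _; rewrite mulr_ge0 ?u0 ?h0.
apply: (@le_trans _ _ (\sum_i w i *
    \sum_(k < n) (if t k < A i then (2 * t k) `^ (p * r) else 0))).
  apply: ler_sum => i _; rewrite ler_wpM2l//.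
  by apply: powR_le_level_sum => //; [rewrite mulr_gt0|exact: A0|exact: Ae|exact: An].
under eq_bigr do rewrite mulr_sumr.
rewrite exchange_big/=.
(* This uses [(2 t)^p (2 / t) = 2^p 2 t^(p - 1)]. Superadditivity then moves the power [r] outside
   the sum, and [Ysum] contributes a further [2^(p - 1)]; in total [2^p 2 2^(p - 1) = 4^p]. *)
apply: (@le_trans _ _ (\sum_(k < n) B *
    (2 `^ p * 2 * (t k `^ (p - 1) * Y k)) `^ r)).
  apply: ler_sum => k _.
  rewrite (eq_bigr (fun i => (2 * t k) `^ (p * r) * (if t k < A i then w i else 0)));
    last by move=> i _; case: ifP => _; rewrite ?mulr0// mulrC.
  rewrite -mulr_sumr -big_mkcond/=.
  rewrite (le_trans (ler_wpM2l (powR_ge0 _ _) (level k)))// mulrCA ler_wpM2l//.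
  rewrite powRrM -powRM ?powR_ge0// ?mulr_ge0 ?invr_ge0 ?(ltW (t0 k))//.
  rewrite le_eqVlt; apply/orP; left; apply/eqP; congr (_ `^ _).
  rewrite powRM ?(ltW (t0 k))// -(mulr_powRB1 (ltW (t0 k)) p0).
  by field; rewrite gt_eqF.
rewrite -mulr_sumr [X in _ <= X * _]mulrC -mulrA ler_wpM2l//.
apply: le_trans (sum_powR_superadd _ _ _ _ _ _ r1 _) _.
  by move=> k; rewrite mulr_ge0 ?mulr_ge0 ?powR_ge0.
have c0 : 0 <= c.
  have := @geometric_level_sum R p 1 1 0 p1 ltr01 ler01.
  by rewrite big_ord0 powR1 mulr1.
have K0 : 0 <= 4 `^ p * c by rewrite mulr_ge0 ?powR_ge0.
rewrite -powRM//.
rewrite ge0_ler_powR ?nnegrE ?(ltW r0)//.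
- by apply: sumr_ge0 => k _; rewrite mulr_ge0 ?mulr_ge0 ?powR_ge0.
- by rewrite mulr_ge0.
rewrite -mulr_sumr.
have k2 : 0 <= 2 `^ p * 2 :> R by rewrite mulr_ge0 ?powR_ge0.
rewrite (le_trans (ler_wpM2l k2 Ysum))//.
have -> : 4 `^ p = 2 `^ p * 2 `^ p :> R by rewrite -powRM// -natrM.
rewrite -(mulr_powRB1 _ p0)//.
by rewrite le_eqVlt; apply/orP; left; apply/eqP; ring.
Qed.

(** * Boxes over dyadic grids *)

Lemma subset_Qbox (R : realType) (a b a' b' : R) :
  a <= a' -> b' <= b -> Qbox a' b' `<=` Qbox a b.
Proof.
move=> aa bb [x y] [/andP[/= ax xb] /andP[y0 yb]].
by split; apply/andP; split => //=; lra.
Qed.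

Lemma disjoint_Qbox (R : realType) (a b a' b' : R) :
  b <= a' -> Qbox a b `&` Qbox a' b' = set0.
Proof.
move=> ba; rewrite -subset0 => -[x y] [[/andP[/= _ xb] _] [/andP[/= ax _] _]].
lra.
Qed.

Lemma Qbox_sub_UHP (R : realType) (a b : R) : Qbox a b `<=` UHP.
Proof. by move=> z [_ /andP[]]. Qed.

Lemma measurable_Qbox (R : realType) (a b : R) : measurable (Qbox a b).
Proof.
rewrite (_ : Qbox a b = `]a, b[ `*` `]0, b - a[); first exact: measurableX.
by apply/seteqP; split => z; rewrite /= !in_itv.
Qed.

Lemma measurable_UHP (R : realType) : measurable (@UHP R).
Proof.
rewrite (_ : UHP = setT `*` `]0, +oo[); first exact: measurableX.
by apply/seteqP; split => z; rewrite /= in_itv/= andbT//; case.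
Qed.

Definition grid_cell (R : realType) (x l a : R) : R * R :=
  let k := Num.floor ((a - x) / l) in (x + k%:~R * l, x + (k + 1)%:~R * l).

Lemma grid_cell_bounds (R : realType) (x l a : R) : 0 < l ->
  (grid_cell R x l a).1 <= a < (grid_cell R x l a).2.
Proof.
move=> l0; rewrite /grid_cell/=; set k := Num.floor _.
have /andP[k1 k2] := floor_itv ((a - x) / l); rewrite -/k in k1 k2.
move: k1; rewrite ler_pdivlMr// => k1.
move: k2; rewrite ltr_pdivrMr// => k2.
by apply/andP; split; lra.
Qed.

Lemma grid_cell_length (R : realType) (x l a : R) :
  (grid_cell R x l a).2 - (grid_cell R x l a).1 = l.
Proof. by rewrite /grid_cell/= intrD; ring. Qed.

(** In units of [l], all end points are integers relative to [x], and the fine interval has length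
    one, so it cannot straddle an end point of the coarse one. *)
Lemma dyadic_intervals_nested (R : realType) (x l : R) (i : nat) (k k' : int) : 0 < l ->
  [\/ x + (k + 1)%:~R * (l * 2 ^+ i) <= x + k'%:~R * l,
      x + (k' + 1)%:~R * l <= x + k%:~R * (l * 2 ^+ i) |
      x + k%:~R * (l * 2 ^+ i) <= x + k'%:~R * l /\
      x + (k' + 1)%:~R * l <= x + (k + 1)%:~R * (l * 2 ^+ i)].
Proof.
move=> l0; have E (m : int) : m%:~R * (l * 2 ^+ i) = (m * 2 ^+ i)%:~R * l :> R.
  by rewrite intrM rmorphXn/=; ring.
have le (m n : int) : m <= n -> x + m%:~R * l <= x + n%:~R * l.
  by move=> mn; rewrite lerD2l ler_pM2r// ler_int.
rewrite !E; have [h|h] := leP ((k + 1) * 2 ^+ i) k'; first by constructor 1; exact: le.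
have [h'|h'] := ltP k' (k * 2 ^+ i); first by constructor 2; apply: le; lia.
by constructor 3; split; apply: le => //; lia.
Qed.

Lemma grid_cells_laminar (R : realType) (x L a a' : R) (j j' : nat) : 0 < L ->
  let Q := grid_cell R x (L / 2 ^+ j) a in let Q' := grid_cell R x (L / 2 ^+ j') a' in
  Qbox Q.1 Q.2 `<=` Qbox Q'.1 Q'.2 \/ Qbox Q'.1 Q'.2 `<=` Qbox Q.1 Q.2 \/
  Qbox Q.1 Q.2 `&` Qbox Q'.1 Q'.2 = set0.
Proof.
move=> L0 /=; wlog jj : a a' j j' / (j <= j')%N.
  move=> H; have [/H|/ltnW/H] := leqP j j'; first exact.
  by move=> /(_ a' a); rewrite setIC; tauto.
have l0 : 0 < L / 2 ^+ j' by rewrite divr_gt0// exprn_gt0.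
have -> : L / 2 ^+ j = L / 2 ^+ j' * 2 ^+ (j' - j).
  have -> : 2 ^+ j' = 2 ^+ (j' - j) * 2 ^+ j :> R by rewrite -exprD subnK.
  by field; rewrite !expf_neq0.
set l := L / 2 ^+ j' in l0 *; set i := (j' - j)%N.
rewrite /grid_cell /=.
have [h|h|[h h']] := dyadic_intervals_nested R x l i
  (Num.floor ((a - x) / (l * 2 ^+ i))) (Num.floor ((a' - x) / l)) l0.
- by right; right; exact: disjoint_Qbox.
- by right; right; rewrite setIC; exact: disjoint_Qbox.
- by right; left; exact: subset_Qbox.
Qed.

(* The end points of the two grids stay at distance at least [l / 3], because
   no power of two is divisible by three. *)
Lemma shifted_grid_cells_cover (R : realType) (L a b : R) (j : nat) :
  0 < L -> 3 * (b - a) <= L / 2 ^+ j ->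
  b <= (grid_cell R 0 (L / 2 ^+ j) a).2 \/ b <= (grid_cell R (L / 3) (L / 2 ^+ j) a).2.
Proof.
move=> L0; set l := L / 2 ^+ j => bl.
have l0 : 0 < l by rewrite divr_gt0// exprn_gt0.
have [//|h0] := leP b (grid_cell R 0 l a).2; first by left.
right; rewrite leNgt; apply/negP => h1.
have /andP[_] := grid_cell_bounds R 0 l a l0.
have /andP[_] := grid_cell_bounds R (L / 3) l a l0.
move: h0 h1; rewrite /grid_cell/=.
set k0 := (_ + 1); set k1 := (_ + 1) => h0 h1 a1 a0.
have LE : L = l * 2 ^+ j by rewrite /l mulfVK// expf_neq0.
(* [n * l] is three times the difference of the right end points of the two cells. Both lie in
   [(a, b)], whose length is at most [l / 3], which would force [|n| < 1]. *)
pose n : int := 3 * (k0 - k1) - 2 ^+ j.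
have nE : n%:~R * l = 3 * (k0%:~R * l - (L / 3 + k1%:~R * l)).
  rewrite LE /n intrB intrM intrB -[2 ^+ j]/(2%:Z ^+ j) rmorphXn/=; by field.
have n0 : n != 0.
  apply/eqP => /eqP; rewrite subr_eq0 => /eqP e.
  have : (3 %| 2 ^ j)%N.
    apply/dvdnP; exists `|k0 - k1|%N; rewrite mulnC.
    by have := congr1 absz e; rewrite abszM abszX.
  by rewrite Euclid_dvdX.
have : 1 <= `|n%:~R : R|.
  by rewrite -intr_norm (_ : 1 = 1%:~R)// ler_int -gtz0_ge1 normr_gt0.
rewrite -(ler_pM2r l0) mul1r -{2}(gtr0_norm l0) -normrM nE leNgt => /negP; apply.
rewrite ltr_norml; apply/andP; split; lra.
Qed.

(** The least [j] with [L / 2^j <= 6 l] works: for [j > 0] the previous scale exceeds [6 l], so this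
    one exceeds [3 l]. *)
Lemma dyadic_scale (R : realType) (L l : R) : 0 < l -> 3 * l <= L ->
  exists j : nat, 3 * l <= L / 2 ^+ j /\ L / 2 ^+ j <= 6 * l.
Proof.
move=> l0 lL.
have ex : exists j : nat, L / 2 ^+ j <= 6 * l.
  exists (Num.truncn (L / l)).+1.
  rewrite ler_pdivrMr ?exprn_gt0//.
  have : L / l <= 2 ^+ (Num.truncn (L / l)).+1.
    rewrite (le_trans (ltW (truncnS_gt _)))// -natrX ler_nat ltnW//.
    exact: ltn_expl.
  rewrite ler_pdivrMr// => h; have : 0 <= 2 ^+ (Num.truncn (L / l)).+1 :> R by exact: exprn_ge0.
  nra.
case: (ex_minnP ex) => -[|j] jl jmin; [exists 0%N|exists j.+1].
  by rewrite expr0 divr1 in jl *.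
split => //; rewrite leNgt; apply/negP => h.
suff /jmin : L / 2 ^+ j <= 6 * l by rewrite ltnn.
have : L / 2 ^+ j = 2 * (L / 2 ^+ j.+1).
  by rewrite exprS; field; rewrite expf_neq0.
lra.
Qed.

(** All cells come from the scales [L / 2^j] of one common [L]. The shift [L / 3] is the same at
    every scale, so each grid stays laminar. *)
Lemma two_laminar_covers (R : realType) (n : nat) (a b : 'I_n -> R) :
  (forall i, a i < b i) ->
  exists J : bool -> 'I_n -> R * R,
  [/\ forall c i, (J c i).1 < (J c i).2 /\ (J c i).2 - (J c i).1 <= 6 * (b i - a i),
      forall c i j, Qbox (J c i).1 (J c i).2 `<=` Qbox (J c j).1 (J c j).2 \/
        Qbox (J c j).1 (J c j).2 `<=` Qbox (J c i).1 (J c i).2 \/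
        Qbox (J c i).1 (J c i).2 `&` Qbox (J c j).1 (J c j).2 = set0 &
      forall i, exists c, Qbox (a i) (b i) `<=` Qbox (J c i).1 (J c i).2].
Proof.
(* Three times any of the lengths is at most [L], as [dyadic_scale] requires; the summand 1 keeps
   [L] positive when [n = 0]. *)
move=> ab; pose L : R := 3 * \sum_i (b i - a i) + 1.
have S0 (P : pred 'I_n) : 0 <= \sum_(i | P i) (b i - a i).
  by apply: sumr_ge0 => i _; rewrite subr_ge0 ltW.
have L0 : 0 < L by have := S0 xpredT; rewrite /L; lra.
have /choice[j jP] (i : 'I_n) : exists j : nat,
    3 * (b i - a i) <= L / 2 ^+ j /\ L / 2 ^+ j <= 6 * (b i - a i).
  apply: dyadic_scale; first by rewrite subr_gt0.
  rewrite /L (bigD1 i)//=; have := S0 (fun k => k != i); lra.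
have l0 i : 0 < L / 2 ^+ j i by rewrite divr_gt0// exprn_gt0.
exists (fun c i => grid_cell R (if c then L / 3 else 0) (L / 2 ^+ j i) (a i)); split.
- move=> c i; rewrite grid_cell_length; split; last by have [] := jP i.
  by rewrite -subr_gt0 grid_cell_length.
- by move=> c i k; exact: grid_cells_laminar.
- move=> i; have [h|h] := shifted_grid_cells_cover R L (a i) (b i) (j i) L0 (jP i).1.
  + exists false; apply: subset_Qbox => //.
    by have /andP[] := grid_cell_bounds R 0 _ (a i) (l0 i).
  + exists true; apply: subset_Qbox => //.
    by have /andP[] := grid_cell_bounds R (L / 3) _ (a i) (l0 i).
Qed.

(** * Weighted boxes and the maximal function *)

(* [leb2] lives over [measurableTypeR R], whose measurable structure is convertible
   to the one on [R] used for [mu] and [sigma], but has another display. *)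
Definition plane (R : realType) := (measurableTypeR R * measurableTypeR R)%type.

Definition plane_leb (R : realType) : {measure set (plane R) -> \bar R} :=
  ((@lebesgue_measure R) \x (@lebesgue_measure R))%E.

Lemma Vint_plane (R : realType) (alpha : R) D (g : R * R -> \bar R) :
  Vint alpha D g = (\int[plane_leb R]_(w in (D : set (plane R))) (g w * (w.2 `^ alpha)%:E))%E.
Proof. reflexivity. Qed.

Lemma measurable_plane (R : realType) (A : set (R * R)) :
  measurable A -> measurable (A : set (plane R)).
Proof. by []. Qed.

Lemma measurable_fun_plane (R : realType) (D : set (R * R)) (f : R * R -> R) :
  measurable_fun D f -> measurable_fun (D : set (plane R)) (f : plane R -> R).
Proof. by move=> mf mD Y mY; exact: mf mD Y mY. Qed.

(** At most one [E i] contains a given point, so the step function with values [a i] lies below [g].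
    With [g] a power of the maximal function of a truncated weight, this turns (b) into the Carleson
    condition. *)
Lemma sum_trivIset_cst_le d (T : measurableType d) (R : realType)
    (mu : {measure set T -> \bar R}) (D : set T) (I : finType) (P : pred I)
    (E : I -> set T) (a : I -> R) (g : T -> \bar R) :
  measurable D -> (forall i, measurable (E i)) -> (forall i, E i `<=` D) ->
  trivIset setT E -> (forall i, 0 <= a i) -> (forall x, D x -> 0 <= g x)%E ->
  (forall i x, P i -> E i x -> (a i)%:E <= g x)%E ->
  (\sum_(i | P i) (a i)%:E * mu (E i) <= \int[mu]_(x in D) g x)%E.
Proof.
move=> mD mE ED tE a0 g0 ag.
rewrite -big_filter -(@integral_sum_cst_indic _ _ _ mu D)//.
apply: ge0_le_integral_nomeas => x Dx; rewrite ?big_filter.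
  by rewrite lee_fin; apply: sumr_ge0 => i _; rewrite mulr_ge0.
have [[i [Pi Eix]]|nE] := pselect (exists i, P i /\ E i x).
  rewrite (bigD1 i)//= big1 ?addr0 => [|j /andP[_ ji]].
    by rewrite indicE mem_set// mulr1 ag.
  rewrite indicE memNset ?mulr0// => Ejx; move/eqP: ji; apply.
  by apply: (tE j i Logic.I Logic.I); exists x.
rewrite big1 ?g0// => i Pi; rewrite indicE memNset ?mulr0// => Eix.
by apply: nE; exists i.
Qed.

(** The Lebesgue density of the measure [|E|_{sigma,alpha}]. Weighted averages are thus quotients of
    integrals against one fixed measure, the form used in [carleson_embedding]. *)
Definition density (R : realType) (sigma : R * R -> R) (alpha : R) (w : R * R) : R :=
  sigma w * w.2 `^ alpha.

Lemma density_ge0 (R : realType) (sigma : R * R -> R) (alpha : R) (w : R * R) :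
  (forall z, 0 <= sigma z) -> 0 <= density R sigma alpha w.
Proof. by move=> s0; rewrite mulr_ge0// powR_ge0. Qed.

Lemma measurable_density (R : realType) (sigma : R * R -> R) (alpha : R) :
  measurable_fun UHP sigma -> measurable_fun UHP (density R sigma alpha).
Proof.
move=> ms; apply: measurable_funM => //.
apply: measurable_funTS; apply: measurableT_comp (measurable_powR _) _.
exact: measurable_snd.
Qed.

Lemma Vint_normM (R : realType) (sigma f : R * R -> R) (alpha : R) (E : set (R * R)) :
  (forall z, 0 <= sigma z) ->
  Vint alpha E (fun w => (`|sigma w * f w|)%:E) =
  (\int[plane_leb R]_(w in (E : set (plane R))) (`|f w| * density R sigma alpha w)%:E)%E.
Proof.
move=> s0; rewrite Vint_plane; apply: eq_integral => w _.
by rewrite -EFinM normrM ger0_norm// /density; congr EFin; ring.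
Qed.

Lemma Vint_powM (R : realType) (sigma f : R * R -> R) (alpha p : R) (E : set (R * R)) :
  Vint alpha E (fun w => (`|f w| `^ p * sigma w)%:E) =
  (\int[plane_leb R]_(w in (E : set (plane R))) (`|f w| `^ p * density R sigma alpha w)%:E)%E.
Proof.
rewrite Vint_plane; apply: eq_integral => w _.
by rewrite -EFinM /density mulrA.
Qed.

Lemma wmeas_density (R : realType) (sigma : R * R -> R) (alpha : R) (E : set (R * R)) :
  wmeas sigma alpha E =
  (\int[plane_leb R]_(w in (E : set (plane R))) (density R sigma alpha w)%:E)%E.
Proof. by []. Qed.

Lemma wmeas_ge0 (R : realType) (sigma : R * R -> R) (alpha : R) (E : set (R * R)) :
  (forall z, 0 <= sigma z) -> (0 <= wmeas sigma alpha E)%E.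
Proof.
by move=> s0; apply: integral_ge0 => w _; rewrite lee_fin density_ge0.
Qed.

(** Holds because [|f| <= 1 + |f|^p] and [sigma] has finite mass on boxes. It allows the integrals
    over boxes to be handled as real numbers. *)
Lemma Vint_norm_fin_num (R : realType) (sigma f : R * R -> R) (alpha p a b : R) :
  1 < p -> is_weight alpha sigma -> measurable_fun UHP f -> a < b ->
  (Vint alpha UHP (fun w => (`|f w| `^ p * sigma w)%:E) < +oo)%E ->
  Vint alpha (Qbox a b) (fun w => (`|sigma w * f w|)%:E) \is a fin_num.
Proof.
move=> p1 [s0 [ms fs]] mf ab; rewrite Vint_powM Vint_normM// => Xfin.
have D0 w : 0 <= density R sigma alpha w by exact: density_ge0.
have mQ : measurable (Qbox a b : set (plane R)).
  exact: (measurable_plane R _ (measurable_Qbox R a b)).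
have mU : measurable (UHP : set (plane R)).
  exact: (measurable_plane R _ (measurable_UHP R)).
have mh : measurable_fun (UHP : set (plane R)) (density R sigma alpha).
  by apply: measurable_fun_plane; exact: measurable_density.
have mg : measurable_fun (UHP : set (plane R))
    (fun w : plane R => (`|f w| `^ p * density R sigma alpha w)%:E).
  apply/measurable_EFinP; apply: measurable_funM => //.
  apply: measurableT_comp (measurable_powR _) _.
  by apply: measurableT_comp => //; exact: measurable_fun_plane.
rewrite ge0_fin_numE; last first.
  by apply: integral_ge0 => w _; rewrite lee_fin mulr_ge0.
apply: (@le_lt_trans _ _ (wmeas sigma alpha (Qbox a b) +
    \int[plane_leb R]_(w in (Qbox a b : set (plane R)))
      (`|f w| `^ p * density R sigma alpha w)%:E)%E).
  rewrite wmeas_density -ge0_integralD//; last 4 first.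
  - by move=> w _; rewrite lee_fin.
  - apply: (measurable_funS mU (@Qbox_sub_UHP R a b)); exact/measurable_EFinP.
  - by move=> w _; rewrite lee_fin mulr_ge0 ?powR_ge0.
  - exact: (measurable_funS mU (@Qbox_sub_UHP R a b)).
  apply: ge0_le_integral_nomeas => w _; first by rewrite lee_fin mulr_ge0.
  rewrite -EFinD lee_fin -[X in _ <= X + _]mul1r -mulrDl ler_wpM2r//.
  have [f1|f1] := leP `|f w| 1; first by rewrite (le_trans f1)// lerDl powR_ge0.
  by rewrite (le_trans (le1r_powR (ltW f1) (ltW p1)))// lerDr.
rewrite lte_add_pinfty ?fs//; apply: le_lt_trans Xfin.
apply: ge0_subset_integral => //; last exact: Qbox_sub_UHP.
by move=> w _; rewrite lee_fin mulr_ge0 ?powR_ge0.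
Qed.

Lemma wmeas_le_Mfrac (R : realType) (sigma : R * R -> R) (alpha gamma a b a' b' : R)
    (z : R * R) :
  (forall z, 0 <= sigma z) -> a' < b' -> Qbox a' b' z -> Qbox a' b' `<=` Qbox a b ->
  (((b' - a') `^ (- (2 + alpha - gamma)))%:E * wmeas sigma alpha (Qbox a' b') <=
    Mfrac alpha gamma (fun w => \1_(Qbox a b) w * sigma w)%R z)%E.
Proof.
move=> s0 ab Qz QQ; apply: ereal_sup_ubound; exists (a', b') => //=.
congr (_ * _)%E; apply: eq_integral => w /set_mem /QQ Qw.
by rewrite indicE mem_set// mul1r ger0_norm.
Qed.

Lemma ge0_le_poweR (R : realType) (r : R) (x y : \bar R) :
  0 <= r -> (0 <= x)%E -> (x <= y)%E -> (x `^ r <= y `^ r)%E.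
Proof.
move=> r0 x0 xy; have y0 := le_trans x0 xy.
by apply: gt0_ler_poweR => //; rewrite in_itv/= ?x0 ?y0 leey.
Qed.

Lemma ge0_integral_weight_eq0 d (T : measurableType d) (R : realType)
    (m : {measure set T -> \bar R}) (A : set T) (h u : T -> R) :
  measurable A -> measurable_fun A h -> measurable_fun A u ->
  (forall x, A x -> 0 <= h x) -> (forall x, A x -> 0 <= u x) ->
  (\int[m]_(x in A) (h x)%:E = 0)%E -> (\int[m]_(x in A) (u x * h x)%:E = 0)%E.
Proof.
move=> mA mh mu h0 u0 int0.
have absE (g : T -> R) : (forall x, A x -> 0 <= g x) ->
    (\int[m]_(x in A) (g x)%:E = \int[m]_(x in A) `|(g x)%:E|)%E.
  by move=> g0; apply: eq_integral => x /set_mem Ax; rewrite gee0_abs ?lee_fin ?g0.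
rewrite absE; last by move=> x Ax; rewrite mulr_ge0 ?u0 ?h0.
apply/(ae_eq_integral_abs _ mA).
  by apply/measurable_EFinP; exact: measurable_funM.
have /(ae_eq_integral_abs _ mA _).1 : (\int[m]_(x in A) `|(h x)%:E| = 0)%E by rewrite -absE.
move=> H; have {H} := H ((measurable_EFinP _ _).2 mh).
by apply: filterS => x H Ax; have [->] := H Ax; rewrite mulr0.
Qed.

(** Here [r] plays the role of [q / p], and the test hypothesis is (b) raised to the power [q]. The
    embedding is applied with [w i = (len i * nu i)^(p r) mu(E i)]. *)
Lemma laminar_two_weight (R : realType) (p r alpha gamma C X : R)
    (mu : {measure set (R * R) -> \bar R}) (sigma f : R * R -> R) (n : nat)
    (J : 'I_n -> R * R) (E : 'I_n -> set (R * R)) :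
  1 < p -> 1 <= r -> 0 <= C -> is_weight alpha sigma -> measurable_fun UHP f ->
  (forall a b : R, (a < b)%R ->
    \int[mu]_(z in UHP)
      (Mfrac alpha gamma (fun w => \1_(Qbox a b) w * sigma w)%R z `^ (p * r)) <=
    C%:E * wmeas sigma alpha (Qbox a b) `^ r)%E ->
  (Vint alpha UHP (fun w => (`|f w| `^ p * sigma w)%:E) = X%:E)%E ->
  (forall i, (J i).1 < (J i).2) ->
  (forall i j, Qbox (J i).1 (J i).2 `<=` Qbox (J j).1 (J j).2 \/
    Qbox (J j).1 (J j).2 `<=` Qbox (J i).1 (J i).2 \/
    Qbox (J i).1 (J i).2 `&` Qbox (J j).1 (J j).2 = set0) ->
  (forall i, measurable (E i)) -> trivIset setT E ->
  (forall i, E i `<=` Qbox (J i).1 (J i).2) ->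
  (\sum_(i < n) ((((J i).2 - (J i).1) `^ (- (2 + alpha - gamma)) *
      fine (Vint alpha (Qbox (J i).1 (J i).2) (fun w => (`|sigma w * f w|)%:E)))
        `^ (p * r))%:E * mu (E i) <=
    ((4 `^ p * (2 `^ (p - 1) / (2 `^ (p - 1) - 1))) `^ r * C * X `^ r)%:E)%E.
Proof.
move=> p1 r1 C0 wsigma mf test hX J12 lamJ mE tE EJ.
have [s0 [ms fs]] := wsigma.
have p0 : 0 < p by lra.
have r0 : 0 < r by lra.
have pr0 : 0 < p * r by rewrite mulr_gt0.
pose Q i := Qbox (J i).1 (J i).2.
pose len i := ((J i).2 - (J i).1) `^ (- (2 + alpha - gamma)).
have len0 i : 0 < len i by rewrite powR_gt0// subr_gt0.
pose nu i := fine (wmeas sigma alpha (Q i)).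
have nuE i : wmeas sigma alpha (Q i) = (nu i)%:E.
  by rewrite fineK// ge0_fin_numE ?wmeas_ge0// fs.
have nu0 i : 0 <= nu i by rewrite fine_ge0// wmeas_ge0.
pose F i := fine (Vint alpha (Q i) (fun w => (`|sigma w * f w|)%:E)).
have FE i : (Vint alpha (Q i) (fun w => (`|sigma w * f w|)%:E) = (F i)%:E)%E.
  by rewrite fineK// (Vint_norm_fin_num _ _ _ _ p)// hX ltry.
have mU := measurable_plane R _ (measurable_UHP R).
have EU i : E i `<=` UHP by apply: subset_trans (EJ i) _; exact: Qbox_sub_UHP.
(* On [E i], with [Q i] inside [Q j], the maximal function of the weight truncated to [Q j] is at
   least [len i * nu i]. *)
have carl j : (\sum_(i | `[< Q i `<=` Q j >]) ((len i * nu i) `^ (p * r))%:E * mu (E i)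
    <= (C * nu j `^ r)%:E)%E.
  rewrite EFinM -poweR_EFin -nuE; apply: le_trans (test _ _ (J12 j)).
  apply: sum_trivIset_cst_le => //.
  - by move=> i; exact: powR_ge0.
  - by move=> z _; exact: poweR_ge0.
  move=> i z /asboolP Qij Eiz.
  rewrite -poweR_EFin; apply: ge0_le_poweR; [exact: ltW|by rewrite lee_fin mulr_ge0// ltW|].
  rewrite EFinM -nuE.
  exact: (wmeas_le_Mfrac R sigma alpha gamma _ _ _ _ z s0 (J12 i) (EJ i z Eiz) Qij).
(* [mu (E i)] may be infinite; the product is finite because it is one of the terms bounded in
   [carl i]. *)
pose w i := fine (((len i * nu i) `^ (p * r))%:E * mu (E i))%E.
have wE i : (((len i * nu i) `^ (p * r))%:E * mu (E i) = (w i)%:E)%E.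
  rewrite fineK// ge0_fin_numE ?mule_ge0 ?lee_fin ?powR_ge0//.
  apply: le_lt_trans (ltry (C * nu i `^ r)); apply: le_trans (carl i).
  rewrite (bigD1 i)/=; last exact/asboolP.
  by apply: leeDl; apply: sume_ge0 => j _; rewrite mule_ge0// lee_fin powR_ge0.
have w0 i : 0 <= w i by rewrite fine_ge0// mule_ge0// lee_fin powR_ge0.
have wF i : (((len i * F i) `^ (p * r))%:E * mu (E i) =
    (w i * (F i / nu i) `^ (p * r))%:E)%E.
  (* On a box of [sigma]-mass zero the integral of [sigma |f|] vanishes as well, so dividing by zero
     does no harm. *)
  have [nu_0|nu_neq0] := eqVneq (nu i) 0.
    have F_0 : F i = 0.
      apply: EFin_inj; rewrite -FE Vint_normM//; apply: ge0_integral_weight_eq0 => //.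
      + exact: (measurable_plane R _ (measurable_Qbox R _ _)).
      + apply: (measurable_funS mU (@Qbox_sub_UHP R _ _)).
        by apply: measurable_fun_plane; exact: measurable_density.
      + apply: (measurable_funS mU (@Qbox_sub_UHP R _ _)).
        by apply: measurableT_comp => //; exact: measurable_fun_plane.
      + by move=> x _; exact: density_ge0.
      + by rewrite -wmeas_density nuE nu_0.
    by rewrite F_0 mulr0 mul0r powR0 ?gt_eqF// mul0e mulr0.
  have nu_gt0 : 0 < nu i by rewrite lt_neqAle eq_sym nu_neq0 nu0.
  have lF : len i * F i = len i * nu i * (F i / nu i) by field.
  have F0 : 0 <= F i.
    by rewrite fine_ge0// integral_ge0// => x _; rewrite mule_ge0 ?lee_fin ?powR_ge0.
  by rewrite lF powRM ?divr_ge0// ?mulr_ge0 ?(ltW (len0 i))// mulrC EFinM -muleA wE EFinM muleC.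
under eq_bigr => i _ do rewrite -/(F i) -/(len i) wF.
rewrite sumEFin lee_fin.
apply: (@carleson_embedding _ (plane R) R (plane_leb R) UHP
  (density R sigma alpha) (fun w => `|f w|) 'I_n Q w nu F C p r X) => //.
- by apply: measurable_fun_plane; exact: measurable_density.
- by apply: measurableT_comp => //; exact: measurable_fun_plane.
- by move=> x _; exact: density_ge0.
- by move=> i; exact: (measurable_plane R _ (measurable_Qbox R _ _)).
- by move=> i; exact: Qbox_sub_UHP.
- by move=> i; rewrite -Vint_normM.
- by rewrite -Vint_powM.
- move=> j; rewrite -lee_fin -sumEFin (le_trans _ (carl j))//.
  by apply: lee_sum => i _; rewrite wE.
Qed.

(** * From laminar families to all intervals *)

(** Rational end points taken outside [[a, b]], within half its length on either side, at most
    double the length. Codes that give no increasing pair of rationals receive the dummy interval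
    [(0, 1)]. *)
Lemma countable_interval_cover (R : realType) :
  exists I : nat -> R * R, (forall n, (I n).1 < (I n).2) /\
    forall a b, a < b ->
      exists n, [/\ (I n).1 <= a, b <= (I n).2 & (I n).2 - (I n).1 <= 2 * (b - a)].
Proof.
pose I n : R * R := if @unpickle (rat * rat)%type n is Some rs then
  if rs.1 < rs.2 then (ratr rs.1, ratr rs.2) else (0, 1) else (0, 1).
exists I; split.
  move=> n; rewrite /I; case: unpickle => [[r s]|] //=.
  by case: ifP => //= rs; rewrite ltr_rat.
move=> a b ab; pose d := (b - a) / 2.
have ad : a - d < a by rewrite /d; lra.
have bd : b < b + d by rewrite /d; lra.
have [r rI] := rat_in_itvoo ad; have [s sI] := rat_in_itvoo bd.
move: rI sI; rewrite !in_itv/= => /andP[r1 r2] /andP[s1 s2].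
exists (pickle (r, s)); rewrite /I pickleK/= -(ltr_rat R).
rewrite (lt_trans r2 (lt_trans ab s1))/= (ltW r2) (ltW s1); split => //.
by rewrite /d in r1 s2; lra.
Qed.

(** [E i] is [Q i] without the sets that beat it, ties going to the smaller index. At each point of
    the union exactly one set wins, and its value is the maximum on the left. *)
Lemma trivIset_argmax d (T : measurableType d) (R : realType) (n : nat)
    (Q : 'I_n -> set T) (c : 'I_n -> R) :
  (forall i, measurable (Q i)) -> (forall i, 0 <= c i) ->
  exists E : 'I_n -> set T, [/\ forall i, measurable (E i), trivIset setT E,
    forall i, E i `<=` Q i &
    forall z, \big[Num.max/0]_(i < n) (c i * \1_(Q i) z) <=
      \sum_(i < n) c i * \1_(E i) z].
Proof.
move=> mQ c0.
pose beats (j i : 'I_n) := (c i < c j) || ((c i == c j) && (j < i)%N).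
pose E i := Q i `\` \bigcup_(j in [set j | beats j i]) Q j.
have EP i z : E i z <-> Q i z /\ forall j, beats j i -> ~ Q j z.
  split => [[Qi nQ]|[Qi nQ]].
    by split => // j ji Qj; apply: nQ; exists j.
  by split => // -[j /= ji Qj]; exact: nQ ji Qj.
exists E; split.
- by move=> i; apply: measurableD => //; apply: fin_bigcup_measurable.
- move=> i j _ _ [z [/EP[Qi nQi] /EP[Qj nQj]]].
  have [//|ij] := eqVneq i j; exfalso.
  have : beats i j \/ beats j i.
    rewrite /beats; case: (ltgtP (c i) (c j)) => _ /=; [by right|by left|].
    by case: ltngtP => [| |/val_inj e]; [left|right|rewrite e eqxx in ij].
  by case => [/nQj|/nQi].
- by move=> i z /EP[].
- move=> z; have S0 : 0 <= \sum_(i < n) c i * \1_(E i) z.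
    by apply: sumr_ge0 => i _; rewrite mulr_ge0.
  apply: bigmax_le => // i _.
  rewrite indicE; have [/set_mem Qi|_] := boolP (z \in Q i); last by rewrite mulr0.
  rewrite mulr1.
  have Pi : `[< Q i z >] by exact/asboolP.
  case: (@Order.TotalTheory.arg_maxP _ _ _ i (fun k => `[< Q k z >]) c Pi) => k Qk kmax.
  have Pk : `[< Q k z >] && (c k == c k) by rewrite Qk eqxx.
  case: (@arg_minnP _ k (fun l => `[< Q l z >] && (c l == c k)) (fun l => l : nat) Pk).
  move=> l /andP[/asboolP Ql /eqP cl] lmin.
  have El : E l z.
    apply/EP; split => // j /orP[cj|/andP[/eqP cj jl]] Qj.
      by move: cj; rewrite cl ltNge; have := kmax j; rewrite asboolT//= => ->.
    have := lmin j; rewrite asboolT//= -cj cl eqxx leqNgt jl => /(_ isT).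
    by [].
  rewrite (bigD1 l)//= indicE mem_set// mulr1 cl.
  rewrite (le_trans (kmax i Pi))// lerDl.
  by apply: sumr_ge0 => j _; rewrite mulr_ge0.
Qed.

Lemma fine_Vint_le (R : realType) (sigma f : R * R -> R) (alpha p a b a' b' : R) :
  1 < p -> is_weight alpha sigma -> measurable_fun UHP f -> a < b -> a' < b' ->
  (Vint alpha UHP (fun w => (`|f w| `^ p * sigma w)%:E) < +oo)%E ->
  Qbox a b `<=` Qbox a' b' ->
  fine (Vint alpha (Qbox a b) (fun w => (`|sigma w * f w|)%:E)) <=
  fine (Vint alpha (Qbox a' b') (fun w => (`|sigma w * f w|)%:E)).
Proof.
move=> p1 wsigma mf ab ab' Xfin QQ.
apply: fine_le; [exact: Vint_norm_fin_num Xfin|exact: Vint_norm_fin_num Xfin|].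
have [s0 [ms _]] := wsigma.
rewrite !Vint_normM//; apply: ge0_subset_integral => //.
- exact: (measurable_plane R _ (measurable_Qbox R a b)).
- exact: (measurable_plane R _ (measurable_Qbox R a' b')).
- apply: (measurable_funS (measurable_plane R _ (measurable_UHP R)) (@Qbox_sub_UHP R _ _)).
  apply/measurable_EFinP; apply: measurable_funM => //.
    by apply: measurableT_comp => //; exact: measurable_fun_plane.
  by apply: measurable_fun_plane; exact: measurable_density.
- by move=> w _; rewrite lee_fin mulr_ge0// density_ge0.
Qed.

Lemma powRN_le_scale (R : realType) (s k l l' : R) : 0 <= s -> 0 < k -> 0 < l ->
  0 < l' -> l' <= k * l -> l `^ (- s) <= k `^ s * l' `^ (- s).
Proof.
move=> s0 k0 l0 l'0 h.
rewrite !powRN ler_pdivlMr ?powR_gt0// mulrC ler_pdivrMr ?powR_gt0//.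
have [k0' l0' l'0'] := And3 (ltW k0) (ltW l0) (ltW l'0).
by rewrite -powRM// ge0_ler_powR ?nnegrE ?mulr_ge0.
Qed.

(** Replacing an interval by a grid cell at most six times as long costs [6^s] before the power
    [p r] is taken. Adding the estimates of the two grids costs the factor 2. *)
Lemma finite_two_weight (R : realType) (p r alpha gamma C X : R)
    (mu : {measure set (R * R) -> \bar R}) (sigma f : R * R -> R) (n : nat)
    (I : 'I_n -> R * R) (E : 'I_n -> set (R * R)) :
  1 < p -> 1 <= r -> gamma < 2 + alpha -> 0 <= C -> is_weight alpha sigma ->
  measurable_fun UHP f ->
  (forall a b : R, (a < b)%R ->
    \int[mu]_(z in UHP)
      (Mfrac alpha gamma (fun w => \1_(Qbox a b) w * sigma w)%R z `^ (p * r)) <=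
    C%:E * wmeas sigma alpha (Qbox a b) `^ r)%E ->
  (Vint alpha UHP (fun w => (`|f w| `^ p * sigma w)%:E) = X%:E)%E ->
  (forall i, (I i).1 < (I i).2) ->
  (forall i, measurable (E i)) -> trivIset setT E ->
  (forall i, E i `<=` Qbox (I i).1 (I i).2) ->
  (\sum_(i < n) ((((I i).2 - (I i).1) `^ (- (2 + alpha - gamma)) *
      fine (Vint alpha (Qbox (I i).1 (I i).2) (fun w => (`|sigma w * f w|)%:E)))
        `^ (p * r))%:E * mu (E i) <=
    ((6 `^ (2 + alpha - gamma)) `^ (p * r) * 2 *
     ((4 `^ p * (2 `^ (p - 1) / (2 `^ (p - 1) - 1))) `^ r * C * X `^ r))%:E)%E.
Proof.
move=> p1 r1 ga C0 wsigma mf test hX I12 mE tE EI.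
have p0 : 0 < p by lra.
have pr0 : 0 < p * r by nra.
set s := 2 + alpha - gamma; have s0 : 0 <= s by rewrite /s; lra.
pose V (Q : R * R) := fine (Vint alpha (Qbox Q.1 Q.2) (fun w => (`|sigma w * f w|)%:E)).
pose c (Q : R * R) := ((Q.2 - Q.1) `^ (- s) * V Q) `^ (p * r).
have V0 Q : 0 <= V Q.
  by rewrite fine_ge0// integral_ge0// => x _; rewrite mule_ge0 ?lee_fin ?powR_ge0.
have [J [J12 lamJ coverJ]] := two_laminar_covers R n (fun i => (I i).1) (fun i => (I i).2) I12.
(* The cell of grid [k] need not cover the [i]-th box, so [E i] is cut down to it. For a grid that
   does cover the box nothing is lost. *)
pose EJ k i := E i `&` Qbox (J k i).1 (J k i).2.
have mEJ k i : measurable (EJ k i) by apply: measurableI => //; exact: measurable_Qbox.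
pose M := (6 `^ s) `^ (p * r).
have M0 : 0 <= M by exact: powR_ge0.
have strong k : (\sum_(i < n) (c (J k i))%:E * mu (EJ k i) <=
    ((4 `^ p * (2 `^ (p - 1) / (2 `^ (p - 1) - 1))) `^ r * C * X `^ r)%:E)%E.
  apply: (laminar_two_weight R p r alpha gamma C X mu sigma f n (J k) (EJ k)) => //.
  - by move=> i; have [] := J12 k i.
  - by move=> i j _ _ [z [[Ei _] [Ej _]]]; apply: tE => //; exists z.
  - by move=> i; exact: subIsetr.
have cJ0 k i : (0 <= (c (J k i))%:E * mu (EJ k i))%E.
  by rewrite mule_ge0// lee_fin powR_ge0.
apply: (@le_trans _ _ (\sum_(i < n) M%:E *
    ((c (J true i))%:E * mu (EJ true i) + (c (J false i))%:E * mu (EJ false i)))%E).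
  apply: lee_sum => i _; rewrite -/(V (I i)) -/(c (I i)).
  have [k QJ] := coverJ i; have [Jk12 Jk6] := J12 k i.
  have EJE : EJ k i = E i by apply: setIidl; exact: subset_trans (EI i) QJ.
  apply: (@le_trans _ _ (M%:E * ((c (J k i))%:E * mu (EJ k i)))%E); last first.
    by rewrite lee_wpmul2l//; case: k {QJ Jk12 Jk6 EJE}; [exact: leeDl|exact: leeDr].
  rewrite EJE muleA -EFinM lee_wpmul2r// lee_fin /M /c -powRM ?powR_ge0// ?mulr_ge0 ?powR_ge0//.
  rewrite ge0_ler_powR ?nnegrE ?(ltW pr0) ?mulr_ge0 ?powR_ge0// mulrA.
  rewrite ler_pM ?powR_ge0//.
    by apply: powRN_le_scale; rewrite ?subr_gt0// ltr0n.
  by apply: (fine_Vint_le R sigma f alpha p) => //; rewrite hX ltry.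
rewrite -ge0_sume_distrr; last by move=> i _; rewrite adde_ge0.
rewrite -mulrA EFinM -/M lee_wpmul2l// big_split/= mulrDl mul1r EFinD.
exact: leeD.
Qed.

(** The supremum of an empty family would be [-oo], so a box containing [z] has to be exhibited: the
    interval centred at [z.1] with radius [z.2] gives one. *)
Lemma Mfrac_ge0 (R : realType) (alpha gamma : R) (f : R * R -> R) (z : R * R) :
  UHP z -> (0 <= Mfrac alpha gamma f z)%E.
Proof.
rewrite /UHP/= => z0; apply: le_ereal_sup_tmp.
set Q := (z.1 - z.2, z.1 + z.2).
exists (((Q.2 - Q.1) `^ (- (2 + alpha - gamma)))%:E *
    Vint alpha (Qbox Q.1 Q.2) (fun w => (`|f w|)%:E))%E.
  exists Q => //; rewrite /Q /Qbox/=; split; first by lra.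
  by split; apply/andP; split; lra.
rewrite mule_ge0 ?lee_fin ?powR_ge0// integral_ge0// => w _.
by rewrite mule_ge0 ?lee_fin ?powR_ge0.
Qed.

Lemma Mfrac_powR_le_lim (R : realType) (p q alpha gamma : R) (sigma f : R * R -> R)
    (I : nat -> R * R) (z : R * R) (L : \bar R) :
  1 < p -> 0 < q -> gamma < 2 + alpha -> is_weight alpha sigma -> measurable_fun UHP f ->
  (Vint alpha UHP (fun w => (`|f w| `^ p * sigma w)%:E) < +oo)%E ->
  (forall a b, a < b ->
    exists n, [/\ (I n).1 <= a, b <= (I n).2 & (I n).2 - (I n).1 <= 2 * (b - a)]) ->
  (forall n, (((((I n).2 - (I n).1) `^ (- (2 + alpha - gamma)) *
      fine (Vint alpha (Qbox (I n).1 (I n).2) (fun w => (`|sigma w * f w|)%:E)))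
        `^ q * \1_(Qbox (I n).1 (I n).2) z)%:E <= L)%E) ->
  UHP z ->
  (Mfrac alpha gamma (fun w => (sigma w * f w)%R) z `^ q <=
    ((2 `^ (2 + alpha - gamma)) `^ q)%:E * L)%E.
Proof.
move=> p1 q0 ga wsigma mf Xfin coverI cL Uz.
set s := 2 + alpha - gamma; have s0 : 0 <= s by rewrite /s; lra.
set M := (2 `^ s) `^ q.
have M0 : 0 <= M by exact: powR_ge0.
have L0 : (0 <= L)%E.
  by apply: le_trans (cL 0%N); rewrite lee_fin mulr_ge0// powR_ge0.
have ML0 : (0 <= M%:E * L)%E by rewrite mule_ge0.
(* The supremum sits inside the power, so each average is compared with the [q]-th root of the
   bound. Enlarging an interval to one of the [I n], at most twice as long, costs [2^s]. *)
have key : (Mfrac alpha gamma (fun w => (sigma w * f w)%R) z <= (M%:E * L) `^ q^-1)%E.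
  apply: ge_ereal_sup => _ [[a b]/= [ab Qz] <-].
  have [n [Ia bI lenI]] := coverI a b ab.
  have QQ := subset_Qbox R _ _ _ _ Ia bI.
  have I12 : (I n).1 < (I n).2 by lra.
  have Vab := Vint_norm_fin_num R sigma f alpha p a b p1 wsigma mf ab Xfin.
  rewrite -(fineK Vab) -EFinM.
  have Vab0 : 0 <= fine (Vint alpha (Qbox a b) (fun w => (`|sigma w * f w|)%:E)).
    by rewrite fine_ge0// integral_ge0// => w _; rewrite mule_ge0 ?lee_fin ?powR_ge0.
  have rootK (x : R) : 0 <= x -> x%:E = ((x `^ q)%:E `^ q^-1)%E.
    by move=> x0; rewrite poweR_EFin -powRrM divff ?gt_eqF// powRr1.
  rewrite [X in (X <= _)%E]rootK; last by rewrite mulr_ge0 ?powR_ge0.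
  apply: ge0_le_poweR; rewrite ?invr_ge0 ?(ltW q0) ?lee_fin ?powR_ge0//.
  apply: le_trans (lee_wpmul2l _ (cL n)); rewrite ?lee_fin//.
  rewrite indicE mem_set ?mulr1; last exact: QQ.
  have V0 : 0 <= fine (Vint alpha (Qbox (I n).1 (I n).2) (fun w => (`|sigma w * f w|)%:E)).
    by rewrite fine_ge0// integral_ge0// => w _; rewrite mule_ge0 ?lee_fin ?powR_ge0.
  rewrite /M -powRM ?mulr_ge0 ?powR_ge0// ge0_ler_powR ?nnegrE ?(ltW q0) ?mulr_ge0 ?powR_ge0//.
  rewrite mulrA ler_pM ?powR_ge0//.
  - by apply: powRN_le_scale; rewrite ?subr_gt0// ltr0n.
  - exact: (fine_Vint_le R sigma f alpha p).
apply: (@le_trans _ _ (((M%:E * L) `^ q^-1) `^ q)%E); last first.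
  by rewrite -poweRrM mulVf ?gt_eqF// poweRe1.
by apply: ge0_le_poweR key; [exact: ltW|exact: Mfrac_ge0].
Qed.

Lemma measurable_fun_bigmax d (T : measurableType d) (R : realType) (D : set T)
    (n : nat) (g : 'I_n -> T -> R) :
  (forall i, measurable_fun D (g i)) ->
  measurable_fun D (fun x => \big[Num.max/0]_(i < n) g i x).
Proof.
elim: n g => [|n ih] g mg.
  by rewrite (_ : (fun _ => _) = cst 0)//; apply/funext => x; rewrite big_ord0.
rewrite (_ : (fun _ => _) =
    g ord0 \max (fun x => \big[Num.max/0]_(i < n) g (lift ord0 i) x)).
  by apply: measurable_maxr => //; exact: ih.
by apply/funext => x; rewrite big_ord_recl.
Qed.

Lemma two_weight_integral (R : realType) (p r alpha gamma C X : R)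
    (mu : {measure set (R * R) -> \bar R}) (sigma f : R * R -> R) :
  1 < p -> 1 <= r -> gamma < 2 + alpha -> 0 <= C -> is_weight alpha sigma ->
  measurable_fun UHP f ->
  (forall a b : R, (a < b)%R ->
    \int[mu]_(z in UHP)
      (Mfrac alpha gamma (fun w => \1_(Qbox a b) w * sigma w)%R z `^ (p * r)) <=
    C%:E * wmeas sigma alpha (Qbox a b) `^ r)%E ->
  (Vint alpha UHP (fun w => (`|f w| `^ p * sigma w)%:E) = X%:E)%E ->
  (\int[mu]_(z in UHP) (Mfrac alpha gamma (fun w => (sigma w * f w)%R) z `^ (p * r)) <=
    ((2 `^ (2 + alpha - gamma)) `^ (p * r) *
     ((6 `^ (2 + alpha - gamma)) `^ (p * r) * 2 *
      ((4 `^ p * (2 `^ (p - 1) / (2 `^ (p - 1) - 1))) `^ r * C * X `^ r)))%:E)%E.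
Proof.
move=> p1 r1 ga C0 wsigma mf test hX.
have p0 : 0 < p by lra.
have pr0 : 0 < p * r by nra.
have [I [I12 coverI]] := countable_interval_cover R.
set M := (2 `^ _) `^ _; set K := _ * 2 * _.
have M0 : 0 <= M by exact: powR_ge0.
pose c n := (((I n).2 - (I n).1) `^ (- (2 + alpha - gamma)) *
  fine (Vint alpha (Qbox (I n).1 (I n).2) (fun w => (`|sigma w * f w|)%:E))) `^ (p * r).
have c0 n : 0 <= c n by exact: powR_ge0.
(* These finite maxima are measurable and increase with [n], as monotone convergence requires; they
   already carry the power [p * r]. *)
pose phi n z := \big[Num.max/0]_(i < n) (c i * \1_(Qbox (I i).1 (I i).2) z).
have phi0 n z : 0 <= phi n z by exact: bigmax_ge_id.
have mphi n : measurable_fun UHP (phi n).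
  apply: measurable_fun_bigmax => i; apply: measurable_funM => //.
  exact: (measurable_indic (measurable_Qbox R _ _)).
have ndphi z m n : (m <= n)%N -> phi m z <= phi n z.
  by move=> mn; exact: (le_bigmax_ord predT (fun i => c i * \1_(Qbox (I i).1 (I i).2) z) mn).
have phi_int n : (\int[mu]_(z in UHP) (phi n z)%:E <= K%:E)%E.
  have [E [mE tE EQ phiE]] := @trivIset_argmax _ _ R n
    (fun i => Qbox (I i).1 (I i).2) (fun i => c i)
    (fun i => measurable_Qbox R _ _) (fun i => c0 i).
  apply: (@le_trans _ _ (\int[mu]_(z in UHP) (\sum_(i < n) c i * \1_(E i) z)%:E)%E).
    by apply: ge0_le_integral_nomeas => z _; rewrite lee_fin; [exact: phi0|exact: phiE].
  rewrite integral_sum_cst_indic//; last 2 first.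
  - exact: measurable_UHP.
  - by move=> i; apply: subset_trans (EQ i) _; exact: Qbox_sub_UHP.
  exact: (finite_two_weight R p r alpha gamma C X mu sigma f n (fun i => I i) E).
pose S z := ereal_sup (range (fun n => (phi n z)%:E)).
have phi_cvg z : (phi n z)%:E @[n --> \oo] --> S z.
  by apply: ereal_nondecreasing_cvgn => m n mn; rewrite lee_fin ndphi.
have phiS n z : ((phi n z)%:E <= S z)%E by apply: ereal_sup_ubound; exists n.
have S0 z : (0 <= S z)%E by apply: le_trans (phiS 0%N z); rewrite lee_fin.
have mEphi n : measurable_fun UHP (fun z => (phi n z)%:E) by exact/measurable_EFinP.
have mS : measurable_fun UHP S by apply: emeasurable_fun_cvg mEphi _ => z _; exact: phi_cvg.
apply: (@le_trans _ _ (\int[mu]_(z in UHP) (M%:E * S z))%E).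
  apply: ge0_le_integral_nomeas => z Uz; first exact: poweR_ge0.
  apply: (Mfrac_powR_le_lim R p _ _ _ _ _ I) => //; first by rewrite hX ltry.
  (* [phi n] runs over the indices below [n], so the interval of index [n] enters first in
     [phi n.+1]. *)
  move=> n; apply: le_trans (phiS n.+1 z).
  rewrite lee_fin.
  exact: (le_bigmax 0 (fun i : 'I_n.+1 => c i * \1_(Qbox (I i).1 (I i).2) z) ord_max).
have mU := measurable_UHP R.
rewrite ge0_integralZl_EFin// EFinM lee_wpmul2l//.
rewrite (eq_integral (fun z => limn (fun n => (phi n z)%:E))); last first.
  by move=> z _; apply/esym/cvg_lim => //; exact: phi_cvg.
rewrite monotone_convergence//; last 2 first.
- by move=> n z _; rewrite lee_fin.
- by move=> z _ m n mn; rewrite lee_fin ndphi.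
apply: lime_le; last by apply: nearW => n; exact: phi_int.
apply: ereal_nondecreasing_is_cvgn => m n mn.
by apply: ge0_le_integral_nomeas => z _; rewrite lee_fin// ndphi.
Qed.

(** * The testing condition *)

(** Condition (a) is applied to the indicator function of the box, with the same constant. *)
Lemma condA_condB (R : realType) (mu : {measure set (R * R) -> \bar R})
    (sigma : R * R -> R) (p q alpha gamma C : R) :
  1 < p -> condA mu sigma p q alpha gamma C -> condB mu sigma p q alpha gamma C.
Proof.
move=> p1 hA a b ab.
have mQ := measurable_Qbox R a b.
have := hA \1_(Qbox a b) (measurable_indic mQ).
rewrite (_ : (fun w => sigma w * \1_(Qbox a b) w) =
    (fun w => \1_(Qbox a b) w * sigma w)); last by apply/funext => w; rewrite mulrC.
suff -> : Vint alpha UHP (fun w => (`|\1_(Qbox a b) w| `^ p * sigma w)%:E) =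
  wmeas sigma alpha (Qbox a b) by [].
rewrite Vint_powM wmeas_density.
rewrite -(setIidr (@Qbox_sub_UHP R a b)) integral_mkcondr setIidr; last exact: Qbox_sub_UHP.
apply: eq_integral => w _; rewrite patchE indicE.
case: ifPn => _; first by rewrite normr1 powR1 mul1r.
by rewrite normr0 powR0 ?mul0r// gt_eqF//; lra.
Qed.

(** The constant for the [q]-th powers: [2^s] from the countable family of intervals, [6^s] and 2
    from the two grids, and the last factor from the Carleson embedding. *)
Definition two_weight_const (R : realType) (p q alpha gamma : R) : R :=
  (2 `^ (2 + alpha - gamma)) `^ q * ((6 `^ (2 + alpha - gamma)) `^ q * 2 *
    (4 `^ p * (2 `^ (p - 1) / (2 `^ (p - 1) - 1))) `^ (q / p)).

Lemma two_weight_const_gt0 (R : realType) (p q alpha gamma : R) :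
  1 < p -> 0 < two_weight_const R p q alpha gamma.
Proof.
move=> p1; rewrite /two_weight_const !mulr_gt0 ?powR_gt0//.
have h : 1 < 2 `^ (p - 1) :> R by apply: powR_gt1; lra.
by rewrite mulr_gt0 ?powR_gt0// divr_gt0; lra.
Qed.

Lemma powR_scaled_root (R : realType) (p q K C x : R) :
  0 < p -> 0 < q -> 0 <= K -> 0 <= C -> 0 <= x ->
  (K * (C `^ q * x `^ (q / p))) `^ q^-1 = K `^ q^-1 * C * x `^ p^-1.
Proof.
move=> p0 q0 K0 C0 x0.
have qp : q / p * q^-1 = p^-1 by field; rewrite !gt_eqF.
rewrite powRM ?mulr_ge0 ?powR_ge0// powRM ?powR_ge0//.
by rewrite -!powRrM divff ?gt_eqF// powRr1// qp mulrA.
Qed.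

Lemma condB_condA (R : realType) (mu : {measure set (R * R) -> \bar R})
    (sigma : R * R -> R) (p q alpha gamma C : R) :
  1 < p -> p <= q -> gamma < 2 + alpha -> is_weight alpha sigma -> 0 < C ->
  condB mu sigma p q alpha gamma C ->
  condA mu sigma p q alpha gamma (two_weight_const R p q alpha gamma `^ q^-1 * C).
Proof.
move=> p1 pq ga wsigma C0 hB f mf.
have p0 : 0 < p by lra.
have q0 : 0 < q by lra.
have r1 : 1 <= q / p by rewrite ler_pdivlMr ?mul1r.
have prE : p * (q / p) = q by field; rewrite gt_eqF.
have K0 := two_weight_const_gt0 R p q alpha gamma p1.
set K := two_weight_const R p q alpha gamma in K0 *.
have KC0 : 0 < K `^ q^-1 * C by rewrite mulr_gt0 ?powR_gt0.
have [s0 _] := wsigma.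
have test (a b : R) : (a < b)%R ->
    (\int[mu]_(z in UHP)
      (Mfrac alpha gamma (fun w => \1_(Qbox a b) w * sigma w)%R z `^ (p * (q / p))) <=
    (C `^ q)%:E * wmeas sigma alpha (Qbox a b) `^ (q / p))%E.
  move=> ab; rewrite prE; set i := (X in (X <= _)%E).
  have i0 : (0 <= i)%E by apply: integral_ge0 => z _; exact: poweR_ge0.
  have -> : i = ((i `^ q^-1) `^ q)%E by rewrite -poweRrM mulVf ?gt_eqF// poweRe1.
  apply: (le_trans (ge0_le_poweR _ _ _ _ (ltW q0) (poweR_ge0 _ _) (hB a b ab))).
  rewrite poweRM ?poweR_ge0 ?lee_fin ?(ltW C0)// poweR_EFin -poweRrM.
  by rewrite (mulrC p^-1).
(* If the right-hand integral of (a) is infinite, the inequality is trivial because the constant is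
   positive. *)
have [Xfin|Xinf] :=
  boolP (Vint alpha UHP (fun w => (`|f w| `^ p * sigma w)%:E) \is a fin_num); last first.
  have -> : Vint alpha UHP (fun w => (`|f w| `^ p * sigma w)%:E) = +oo%E.
    apply/eqP; move: Xinf; rewrite ge0_fin_numE ?ltey ?negbK//.
    by apply: integral_ge0 => w _; rewrite mule_ge0 ?lee_fin ?powR_ge0// mulr_ge0 ?powR_ge0.
  by rewrite poweRyr ?invr_eq0 ?gt_eqF// gt0_muley ?lte_fin// leey.
set X := Vint _ _ _ in Xfin *.
have X0 : (0 <= X)%E.
  by apply: integral_ge0 => w _; rewrite mule_ge0 ?lee_fin ?powR_ge0// mulr_ge0 ?powR_ge0.
have := two_weight_integral R p (q / p) alpha gamma (C `^ q) (fine X) mu sigma f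
  p1 r1 ga (powR_ge0 _ _) wsigma mf test (esym (fineK Xfin)).
have assoc (x1 x2 x3 x4 x5 : R) :
  x1 * (x2 * 2 * (x3 * x4 * x5)) = x1 * (x2 * 2 * x3) * (x4 * x5) by ring.
rewrite prE assoc -/(two_weight_const R p q alpha gamma) -/K => int_le.
have i0 : (0 <= \int[mu]_(z in UHP) (Mfrac alpha gamma (fun w => (sigma w * f w)%R) z `^ q))%E.
  by apply: integral_ge0 => z _; exact: poweR_ge0.
have q10 : 0 <= q^-1 by rewrite invr_ge0 ltW.
apply: (le_trans (ge0_le_poweR _ _ _ _ q10 i0 int_le)).
rewrite -[Y in (_ <= _ * Y `^ _)%E](fineK Xfin) !poweR_EFin -EFinM lee_fin.
by rewrite powR_scaled_root ?fine_ge0 ?(ltW K0) ?(ltW C0).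
Qed.

(** [testSup] leaves out the boxes of mass zero. For these, (b) holds because the truncated weight
    integrates to zero over every box, so its maximal function vanishes. *)
Lemma LqM_indic_null (R : realType) (mu : {measure set (R * R) -> \bar R})
    (sigma : R * R -> R) (q alpha gamma a b : R) :
  0 < q -> is_weight alpha sigma -> wmeas sigma alpha (Qbox a b) = 0%E ->
  LqM mu q alpha gamma (fun w => (\1_(Qbox a b) w * sigma w)%R) = 0%E.
Proof.
move=> q0 [s0 [ms _]] w0; rewrite /LqM.
suff M0 z : UHP z -> Mfrac alpha gamma (fun w => (\1_(Qbox a b) w * sigma w)%R) z = 0%E.
  rewrite (eq_integral (cst 0%E)) ?integral0 ?poweR0r ?invr_eq0 ?gt_eqF//.
  by move=> z /set_mem Uz; rewrite M0// poweR0r ?gt_eqF.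
move=> Uz; apply/eqP; rewrite eq_le Mfrac_ge0// andbT.
apply: ge_ereal_sup => _ [[a' b']/= _ <-].
suff -> : Vint alpha (Qbox a' b') (fun w => (`|\1_(Qbox a b) w * sigma w|)%:E) = 0%E.
  by rewrite mule0.
apply/eqP; rewrite eq_le; apply/andP; split; last first.
  by apply: integral_ge0 => w _; rewrite mule_ge0 ?lee_fin ?powR_ge0.
rewrite -w0 wmeas_density Vint_plane.
rewrite (@eq_integral _ (plane R) R (plane_leb R) _
  ((fun w : plane R => (density R sigma alpha w)%:E) \_ (Qbox a b))); last first.
  move=> w _; rewrite patchE indicE; case: ifPn => _; last by rewrite mul0r normr0 mul0e.
  by rewrite mul1r ger0_norm.
have mQ a1 b1 := measurable_plane R _ (measurable_Qbox R a1 b1).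
rewrite -integral_mkcondr; apply: ge0_subset_integral => //.
- exact: measurableI.
- apply: (measurable_funS (measurable_plane R _ (measurable_UHP R)) (@Qbox_sub_UHP R _ _)).
  by apply/measurable_EFinP; apply: measurable_fun_plane; exact: measurable_density.
- by move=> w _; rewrite lee_fin density_ge0.
Qed.

Lemma testSup_le (R : realType) (mu : {measure set (R * R) -> \bar R})
    (sigma : R * R -> R) (p q alpha gamma C : R) :
  0 < q -> is_weight alpha sigma -> 0 <= C ->
  (testSup mu sigma p q alpha gamma <= C%:E)%E <-> condB mu sigma p q alpha gamma C.
Proof.
move=> q0 wsigma C0; have [s0 [ms fs]] := wsigma.
have wE a b : a < b -> wmeas sigma alpha (Qbox a b) =
    (fine (wmeas sigma alpha (Qbox a b)))%:E.
  by move=> ab; rewrite fineK// ge0_fin_numE ?wmeas_ge0// fs.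
split => [hS a b ab|hB].
  have := wmeas_ge0 R sigma alpha (Qbox a b) s0.
  rewrite le_eqVlt => /predU1P[/esym w0|w0].
    by rewrite LqM_indic_null// mule_ge0 ?poweR_ge0.
  have wf0 : 0 < fine (wmeas sigma alpha (Qbox a b)).
    by rewrite -lte_fin -wE.
  rewrite (wE a b ab) poweR_EFin -lee_pdivrMr ?powR_gt0//.
  apply: le_trans hS; apply: ereal_sup_ubound; right.
  by exists (a, b) => //; split.
apply: ge_ereal_sup => _ [->|[[a b]/= [ab w0] <-]]; first by rewrite lee_fin.
have wf0 : 0 < fine (wmeas sigma alpha (Qbox a b)) by rewrite -lte_fin -wE.
rewrite lee_pdivrMr ?powR_gt0// -poweR_EFin -wE//; exact: hB.
Qed.

Theorem theorem2p4 (R : realType) (p q alpha gamma : R) :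
  1 < p -> p <= q -> -1 < alpha -> 0 <= gamma -> gamma < 2 + alpha ->
  exists c K : R, 0 < c /\ 0 < K /\
    forall (mu : {measure set (R * R) -> \bar R}) (sigma : R * R -> R),
      is_weight alpha sigma ->
      ((exists C1 : R, 0 < C1 /\ condA mu sigma p q alpha gamma C1) <->
       (exists C2 : R, 0 < C2 /\ condB mu sigma p q alpha gamma C2)) /\
      (c%:E * testSup mu sigma p q alpha gamma <= bestA mu sigma p q alpha gamma)%E /\
      (bestA mu sigma p q alpha gamma <= K%:E * testSup mu sigma p q alpha gamma)%E.
Proof.
move=> p1 pq _ _ ga.
have q0 : 0 < q by lra.
pose K := two_weight_const R p q alpha gamma `^ q^-1.
have K0 : 0 < K by rewrite powR_gt0// two_weight_const_gt0.
exists 1, K; split => //; split => // mu sigma wsigma.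
have BA C : 0 < C -> condB mu sigma p q alpha gamma C ->
    condA mu sigma p q alpha gamma (K * C).
  by move=> C0; exact: condB_condA.
split; last split.
- split => -[C [C0 hC]].
    by exists C; split => //; exact: condA_condB hC.
  by exists (K * C); split; [rewrite mulr_gt0|exact: BA].
- rewrite mul1e; apply: le_ereal_inf_tmp => _ [C [C0 hC] <-].
  by apply/testSup_le => //; [exact: ltW|exact: condA_condB hC].
- have T0 : (0 <= testSup mu sigma p q alpha gamma)%E.
    by apply: ereal_sup_ubound; left.
  case TE : (testSup mu sigma p q alpha gamma) T0 => [t| |//] T0; last first.
    by rewrite gt0_muley ?lte_fin// leey.
  (* The supremum [t] may be 0, whereas the constants in (a) and (b) must be positive. Hence (b) is
     used with [t + e / K], and [e] is arbitrary. *)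
  apply/lee_addgt0Pr => e e0.
  have t0 : 0 <= t by [].
  have C0 : 0 < t + e / K by rewrite ltr_wpDl// divr_gt0.
  rewrite -EFinM -EFinD (_ : K * t + e = K * (t + e / K)); last first.
    by field; rewrite gt_eqF.
  apply: ereal_inf_lbound; exists (K * (t + e / K)) => //; split.
    by rewrite mulr_gt0.
  apply: BA => //; apply/testSup_le => //; first exact: ltW.
  by rewrite TE lee_fin lerDl divr_ge0 ?ltW.
Qed.
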